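(* Let $\lambda,\sigma\in\mathbb C$ satisfy $2\Re(\lambda)+|\sigma|^2<0$, and consider the stochastic TR-BDF2 scheme applied with step $h>0$ to the test equation ${\rm d}X_t=\lambda X_t\,{\rm d}t+\sigma X_t\,{\rm d}W_t$, written as $Y_{n+1}=R\,Y_n$, where $R=R(h,\lambda,\sigma,I_\alpha)$ is the resulting random factor. There exists $h^\ast>0$ such that for all $0<h<h^\ast$ the scheme is $MS$-stable, i.e. $E\left[|R(h,\lambda,\sigma,I_\alpha)|^2\right]<1$.
   Context: $W$ is a real scalar Wiener process. Parameters: $\gamma=2-\sqrt2$, $\gamma_2=\frac{1-\gamma}{2-\gamma}$, $\gamma_3=\frac1{\gamma(2-\gamma)}$; $t_n=nh$, $t_{n+\gamma}=t_n+\gamma h$. Multi-indices $\alpha=(j_1,\dots,j_l)$ have entries in $\{0,1\}$; $l(\alpha)$ is the length and $n(\alpha)$ the number of zeros. With ${\rm d}W^0_t={\rm d}t$, ${\rm d}W^1_t={\rm d}W_t$, the multiple Itô integrals are $I_{\alpha,s,t}=\int_s^tI_{\alpha^-,s,r}\,{\rm d}W_r^{j_l}$, where $\alpha^-$ is $\alpha$ without its last entry and $I_{v,s,t}=1$ for the empty multi-index $v$; $\Delta W_{s,t}=I_{(1),s,t}=W_t-W_s$. Let $\mathcal A$ be the set of multi-indices with $l(\alpha)+n(\alpha)\le4$ and $l(\alpha)\ne n(\alpha)$, that is, $\mathcal A=\{(1),(1,1),(1,0),(0,1),(1,1,1),(1,1,0),(1,0,1),(0,1,1),(1,1,1,1)\}$,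 and put $$s_{u,t}=\sum_{\alpha\in\mathcal A}\lambda^{n(\alpha)}\sigma^{l(\alpha)-n(\alpha)}I_{\alpha,u,t},\qquad \theta_{u,t}=\lambda\sigma\,\Delta W_{u,t}+\lambda\sigma^2I_{(1,1),u,t}.$$ The stochastic TR-BDF2 scheme applied to the test equation (drift $\lambda x$, diffusion $\sigma x$) reads: given $Y_0$, for $n=0,1,\dots$, $$Y_{n+\gamma}=Y_n+\tfrac12\lambda(Y_n+Y_{n+\gamma})h\gamma+\left(s_{t_n,t_{n+\gamma}}-\tfrac12h\gamma\,\theta_{t_n,t_{n+\gamma}}\right)Y_n,$$ $$Y_{n+1}=\gamma_3Y_{n+\gamma}+(1-\gamma_3)Y_n+\lambda Y_{n+1}h\gamma_2+(1-\gamma_3)\left(s_{t_n,t_{n+\gamma}}-h\gamma\,\theta_{t_n,t_{n+\gamma}}\right)Y_n+\left(s_{t_{n+\gamma},t_{n+1}}-h\gamma_2\,\theta_{t_{n+\gamma},t_{n+1}}\right)Y_{n+\gamma}.$$ Solving these linear equations gives $Y_{n+1}=R\,Y_n$ with a random factor $R$ depending only on $h,\lambda,\sigma$ and the integrals $I_\alpha$ over $[t_n,t_{n+\gamma}]$ and $[t_{n+\gamma},t_{n+1}]$; its distribution does not depend on $n$. *)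

(* Defs.v *)
From HB Require Import structures.
From mathcomp Require Import all_boot all_order all_algebra.
From mathcomp Require Import complex.
From mathcomp Require Import all_classical all_reals all_analysis.
From mathcomp Require Import ring.

Set Implicit Arguments.
Unset Strict Implicit.
Unset Printing Implicit Defensive.

Import Order.TTheory GRing.Theory Num.Theory.
Import numFieldNormedType.Exports.

Local Open Scope classical_set_scope.
Local Open Scope ring_scope.
Local Open Scope complex_scope.

Section ItoIntegral.
Context (d : measure_display) (T : measurableType d) (R : realType).
Context (P : probability T R) (W : R -> {RV P >-> R}).

(** The sigma-algebra generated by the W u, 0 <= u <= t. *)
Definition past (t : R) : set (set T) :=
  <<s \bigcup_(u in `[0%R, t]) preimage_set_system setT (W u) measurable >>.

Definition past_measurable (t : R) (X : T -> R) : Prop :=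
  forall B : set R, measurable B -> past t (X @^-1` B).

Record wiener_process : Prop := WienerProcess {
  wiener_start : {ae P, forall w, W 0 w = 0} ;
  wiener_gauss : forall (s t : R), 0 <= s -> s < t ->
    forall B : set R, measurable B ->
      P ((W t \- W s) @^-1` B) = normal_prob 0 (Num.sqrt (t - s)) B ;
  wiener_indep : forall (s t : R), 0 <= s -> s < t ->
    forall (A : set T) (B : set R), past s A -> measurable B ->
      P (A `&` (W t \- W s) @^-1` B) = (P A * P ((W t \- W s)%R @^-1` B))%E ;
  wiener_cont : {ae P, forall w,
    {within `[0, +oo[, continuous (fun t : R => W t w)}} }.

(** Bounded simple adapted processes on [s, t]: the value is [sp_coef i] on
    ]sp_time i, sp_time i.+1], for i < sp_size. *)
Record simple_process (s t : R) := SimpleProcess {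
  sp_size : nat ;
  sp_time : nat -> R ;
  sp_coef : nat -> T -> R ;
  sp_time0 : sp_time 0%N = s ;
  sp_timen : sp_time sp_size = t ;
  sp_time_le : forall i, (i < sp_size)%N -> sp_time i <= sp_time i.+1 ;
  sp_adapted : forall i, (i < sp_size)%N ->
    past_measurable (sp_time i) (sp_coef i) ;
  sp_bounded : exists M : R, forall i w, (i < sp_size)%N ->
    `|sp_coef i w| <= M }.

Definition simple_value s t (f : simple_process s t) (r : R) (w : T) : R :=
  \sum_(i < sp_size f)
    sp_coef f i w * \1_(`]sp_time f i, sp_time f i.+1]%classic) r.

Definition simple_integral s t (f : simple_process s t) (w : T) : R :=
  \sum_(i < sp_size f)
    sp_coef f i w * (W (sp_time f i.+1) w - W (sp_time f i) w).

(** J is (a version of) the Ito integral of the process X over [s, t]: the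
    L^2 limit of the integrals of simple processes that approximate X in
    L^2([s, t] x T). *)
Definition ito_integral (X : R -> T -> R) (s t : R) (J : T -> R) : Prop :=
  exists f : nat -> simple_process s t,
    (fun k => (\int[P]_w \int[lebesgue_measure]_(r in `[s, t])
        (((X r w - simple_value (f k) r w) ^+ 2)%R)%:E)%E) @ \oo --> 0%E /\
    (fun k => ('E_P[fun w => ((J w - simple_integral (f k) w) ^+ 2)%R])%E)
        @ \oo --> 0%E.

(** Entries: false stands for 0 (integration in dt), true for 1 (in dW). *)
Definition multi_index := seq bool.

(** [I a s t] is the multiple Ito integral I_{a,s,t}, for 0 <= s <= t.  Since
    these integrals are only determined up to null sets, a jointly measurable
    version in (t, w) is chosen; it is what gives a meaning to the integrals
    in dt. *)
Record multiple_ito_integrals (I : multi_index -> R -> R -> T -> R) : Prop :=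
  MultipleItoIntegrals {
  mii_measurable : forall a (s : R), 0 <= s ->
    measurable_fun (`[s, +oo[%classic `*` [set: T])
      (fun p : R * T => I a s p.1 p.2) ;
  mii_nil : forall (s t : R), 0 <= s -> s <= t ->
    {ae P, forall w, I [::] s t w = 1} ;
  mii_dt : forall a (s t : R), 0 <= s -> s <= t ->
    {ae P, forall w, I (rcons a false) s t w =
      (\int[lebesgue_measure]_(r in `[s, t]) I a s r w)%R} ;
  mii_dW : forall a (s t : R), 0 <= s -> s <= t ->
    ito_integral (I a s) s t (I (rcons a true) s t) }.

End ItoIntegral.

Definition mi_zeros (a : multi_index) : nat := count_mem false a.

Definition mi_set : seq multi_index :=
  [:: [:: true];
      [:: true; true]; [:: true; false]; [:: false; true];
      [:: true; true; true]; [:: true; true; false];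
      [:: true; false; true]; [:: false; true; true];
      [:: true; true; true; true]].

Lemma mi_set_uniq : uniq mi_set.
Proof. by []. Qed.

Lemma mem_mi_set (a : multi_index) :
  (a \in mi_set) =
  (size a + mi_zeros a <= 4)%N && (size a != mi_zeros a).
Proof.
case: a => [|[] [|[] [|[] [|[] [|b a]]]]] //=;
by rewrite /mi_zeros /= !addnS !addSn.
Qed.

Section Scheme.
Context (R : realType).
Implicit Types (h : R) (la si y : R[i]) (i : multi_index -> R).

Definition gam : R := 2 - Num.sqrt 2.
Definition gam2 : R := (1 - gam) / (2 - gam).
Definition gam3 : R := 1 / (gam * (2 - gam)).

(** [i1], [i2] are the values of the multiple integrals over an interval. *)
Definition ito_sum la si i1 : R[i] :=
  \sum_(a <- mi_set)
    la ^+ mi_zeros a * si ^+ (size a - mi_zeros a) * (i1 a)%:C.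

Definition ito_theta la si i1 : R[i] :=
  la * si * (i1 [:: true])%:C + la * si ^+ 2 * (i1 [:: true; true])%:C.

(** One step y = Y_n, yg = Y_{n+gam}, y1 = Y_{n+1} on the test equation; i1
    and i2 are the integrals over [t_n, t_{n+gam}] and [t_{n+gam}, t_{n+1}]. *)
Definition trbdf2_step h la si i1 i2 (y yg y1 : R[i]) : Prop :=
  yg = y + 1 / 2 * la * (y + yg) * h%:C * gam%:C
         + (ito_sum la si i1 - 1 / 2 * h%:C * gam%:C * ito_theta la si i1) * y
  /\
  y1 = gam3%:C * yg + (1 - gam3%:C) * y + la * y1 * h%:C * gam2%:C
         + (1 - gam3%:C)
             * (ito_sum la si i1 - h%:C * gam%:C * ito_theta la si i1) * y
         + (ito_sum la si i2 - h%:C * gam2%:C * ito_theta la si i2) * yg.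

Definition trbdf2_factor h la si i1 i2 (rho : R[i]) : Prop :=
  forall y yg y1, trbdf2_step h la si i1 i2 y yg y1 -> y1 = rho * y.

Lemma gam_bounds : 0 < gam < 1.
Proof.
have lo : 1 < Num.sqrt (2 : R) by rewrite -[ltLHS]sqrtr1 ltr_sqrt ?ltr1n.
have hi : Num.sqrt (2 : R) < 2.
  rewrite -[ltRHS](@ger0_norm R) ?ler0n// -sqrtr_sqr ltr_sqrt ?exprn_gt0//.
  by rewrite expr2 -natrM ltr_nat.
by rewrite /gam subr_gt0 hi/= ltrBlDr -ltrBlDl (_ : 2 - 1 = 1 :> R)// mulr2n addrK.
Qed.

Lemma implicit_coef_neq0 la (c : R) :
  complex.Re la < 0 -> 0 < c -> 1 - la * c%:C != 0.
Proof.
case: la => a b /= a0 c0; apply/eqP => /(congr1 (@complex.Re R)) /=.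
rewrite mulr0 subr0 => /eqP; rewrite subr_eq0 => /eqP h1.
have : a * c < 0 by rewrite pmulr_llt0.
by rewrite -h1 ltr10.
Qed.

(** When Re la < 0 the two implicit stages are uniquely solvable. *)
Lemma trbdf2_stepP h la si i1 i2 : 0 < h -> complex.Re la < 0 ->
  exists q rho : R[i], forall y yg y1,
    trbdf2_step h la si i1 i2 y yg y1 <-> yg = q * y /\ y1 = rho * y.
Proof.
move=> h0 la0; have /andP[g0 g1] := gam_bounds.
have g20 : 0 < gam2.
  by rewrite divr_gt0 ?subr_gt0// (lt_trans g1)// ltr1n.
have dg : 1 - la * (1 / 2 * h * gam)%:C != 0.
  by rewrite implicit_coef_neq0// !mulr_gt0// invr_gt0 ltr0n.
have d1 : 1 - la * (h * gam2)%:C != 0.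
  by rewrite implicit_coef_neq0// mulr_gt0.
pose u := ito_sum la si i1; pose v := ito_sum la si i2.
pose p := ito_theta la si i1; pose t := ito_theta la si i2.
have ha : (1 / 2 * h * gam)%:C = 1 / 2 * h%:C * gam%:C :> R[i].
  by rewrite !rmorphM /= fmorphV rmorph1 rmorph_nat.
have hb : (h * gam2)%:C = h%:C * gam2%:C :> R[i] by rewrite rmorphM.
rewrite ha in dg; rewrite hb in d1.
set k := 1 / 2 * h%:C * gam%:C in dg *.
set m := h%:C * gam2%:C in d1 *.
pose q := (1 + la * k + (u - k * p)) / (1 - la * k).
pose N := gam3%:C * q + (1 - gam3%:C)
  + (1 - gam3%:C) * (u - h%:C * gam%:C * p) + (v - m * t) * q.
have qE : q * (1 - la * k) = 1 + la * k + (u - k * p) by rewrite divfK.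
exists q, (N / (1 - la * m)) => y yg y1.
have rhoE : N / (1 - la * m) * (1 - la * m) = N by rewrite divfK.
move: (N / _) rhoE => rho rhoE; clearbody q.
rewrite /trbdf2_step -/u -/v -/p -/t -/k -/m.
have -> : 1 / 2 * la * (y + yg) * h%:C * gam%:C = la * (y + yg) * k.
  by rewrite /k; ring.
have -> : la * y1 * h%:C * gam2%:C = la * y1 * m by rewrite /m; ring.
clearbody k m; split=> [[E1 E2]|[-> ->]].
  have Hq : yg = q * y.
    apply: (mulfI dg); rewrite mulrA [_ * q]mulrC qE.
    by rewrite mulrBl {1}E1; ring.
  split=> //; apply: (mulfI d1); rewrite mulrA [_ * rho]mulrC rhoE.
  by rewrite mulrBl {1}E2 Hq /N; ring.
split; apply/eqP; rewrite -subr_eq0; apply/eqP.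
  rewrite [LHS](_ : _ = (q * (1 - la * k) - (1 + la * k + (u - k * p))) * y).
    by rewrite qE subrr mul0r.
  by ring.
rewrite [LHS](_ : _ = (rho * (1 - la * m) - N) * y).
  by rewrite rhoE subrr mul0r.
by rewrite /N; ring.
Qed.

Lemma trbdf2_factor_exists h la si i1 i2 : 0 < h -> complex.Re la < 0 ->
  exists! rho : R[i], trbdf2_factor h la si i1 i2 rho.
Proof.
move=> h0 la0; have [q [rho H]] := trbdf2_stepP si i1 i2 h0 la0.
exists rho; split=> [y yg y1 /H[]//|rho' H'].
have := H' 1 (q * 1) (rho * 1) (proj2 (H _ _ _) (conj erefl erefl)).
by rewrite !mulr1.
Qed.

Definition tn h (n : nat) : R := n%:R * h.
Definition tng h (n : nat) : R := tn h n + gam * h.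

Definition trbdf2_random_factor (T : Type)
    (I : multi_index -> R -> R -> T -> R) h la si (n : nat)
    (rho : T -> R[i]) : Prop :=
  forall w, trbdf2_factor h la si
    (fun a => I a (tn h n) (tng h n) w)
    (fun a => I a (tng h n) (tn h n.+1) w) (rho w).

End Scheme.

Definition MS_stable (d : measure_display) (T : measurableType d)
    (R : realType) (P : probability T R) (rho : T -> R[i]) : Prop :=
  ('E_P[fun w => (Normc.normc (rho w) ^+ 2)%R] < 1)%E.

(* Main.v *)
Require Import Defs.
From HB Require Import structures.
From mathcomp Require Import all_boot all_order all_algebra.
From mathcomp Require Import complex.
From mathcomp Require Import all_classical all_reals all_analysis.
From mathcomp Require Import measurable_realfun.
From mathcomp Require Import ring lra.

(** Write X1, X2 for the increments of the Wiener process over [t_n,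
    t_{n+gam}] and [t_{n+gam}, t_{n+1}], and I11, J11 for the double
    integrals over these two intervals. Solving the two implicit stages
    expands the factor of one step as

      D + (c1 X1 + c2 X2) + (c11 I11 + c22 J11 + c12 X1 X2) + Q

    with deterministic coefficients (trbdf2_factorE). The parameters of the
    scheme satisfy 2 gam3 (gam / 2) + gam2 = 1, which is consistency of
    order one: D = 1 + la h + O(h^2), while c1 and c2 are si + O(h). The
    five displayed random variables are centred, and X1 X2 being centred
    makes X1 and X2 orthogonal. Hence the mean square of the factor without
    Q is at most |D|^2 + |si|^2 h + o(h), that is 1 + (2 Re la + |si|^2) h +
    o(h). Every monomial of Q carries total degree at least three, counting
    1 for each dW and 2 for each dt and each factor h, so E|Q|^2 = O(h^3),
    and Q shifts the mean square by o(h) only. The cross terms are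
    controlled by |x + y|^2 <= (1 + e) |x|^2 + (1 + 1/e) |y|^2 in place of
    the Cauchy-Schwarz inequality, which keeps the whole computation inside
    expectations of squares; the free parameter e is chosen in small_step
    from the gap -(2 Re la + |si|^2).

    The probabilistic input consists of three facts on the multiple
    integrals I_a(s, t), where deg a = l(a) + n(a). First, E I_a(s, t)^2 =
    O((t - s)^(deg a)), with the sharp constant for the increment (msq_mii).
    Secondly, E (I_b(s, t) I_a(r, s))^2 = O((t - s)^(deg b) (s - r)^(deg a))
    for consecutive intervals (msq_mii_mii). Thirdly, integrals in dW, and
    products of two such integrals over consecutive intervals, are centred
    (mean0_dW, mean0_dW_dW).

    They all rest on E J^2 <= E int X^2 for an Ito integral J of X
    (ito_msq), which is inherited from simple processes by L^2
    approximation. A bounded factor g that depends on the past up to s only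
    can be moved inside an Ito integral over [s, t] (ito_mul); so the same
    inequality yields E (g I_a(s, t))^2 <= C E g^2, a conditional bound
    obtained from unconditional ones. For the product bound one then has to
    pass from bounded g to the integrals over the earlier interval: an
    integral in dW is an L^2 limit of such g (ito_closure), and an integral
    in dt is reduced to its integrand by the pathwise Cauchy-Schwarz
    inequality and Tonelli (msq_dt). *)

Set Implicit Arguments.
Unset Strict Implicit.
Unset Printing Implicit Defensive.

Import Order.TTheory GRing.Theory Num.Theory.
Import numFieldNormedType.Exports.

Local Open Scope classical_set_scope.
Local Open Scope ring_scope.

(** * Moments of the normal law *)

Section Gaussian.
Context (R : realType).
Local Notation mu := lebesgue_measure.

(** The normal law is given through its values on Borel sets; uniqueness of
    the Radon-Nikodym derivative turns it into a density. *)
Lemma ge0_integral_normal_prob (m s : R) (f : R -> \bar R) :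
  measurable_fun setT f -> (forall x, 0 <= f x)%E ->
  (\int[normal_prob m s]_x f x = \int[mu]_x (f x * (normal_pdf m s x)%:E))%E.
Proof.
move=> mf f0; have dom := @normal_prob_dominates R m s.
have mpdf : measurable_fun [set: R] (EFin \o normal_pdf m s).
  by apply/measurable_EFinP; exact: measurable_normal_pdf.
rewrite -(Radon_Nikodym_SigmaFinite.change_of_variables dom)//.
have mRN := measurable_int _ (Radon_Nikodym_SigmaFinite.f_integrable dom).
apply: ge0_ae_eq_integral => //.
- exact: emeasurable_funM.
- exact: emeasurable_funM.
- by move=> x _; rewrite mule_ge0// Radon_Nikodym_SigmaFinite.f_ge0.
- by move=> x _; rewrite mule_ge0// lee_fin normal_pdf_ge0.
apply: ae_eqe_mul2l; apply: integral_ae_eq => //.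
  exact: Radon_Nikodym_SigmaFinite.f_integrable.
by move=> E _ mE; rewrite -Radon_Nikodym_SigmaFinite.f_integral.
Qed.

(** Completing the square: tilting a centred normal density by exp(t x) gives,
    up to a constant, the density shifted by t s^2. *)
Lemma integral_normal_prob_expR (s t : R) : s != 0 ->
  (\int[normal_prob 0 s]_x (expR (t * x))%:E =
    (expR (t ^+ 2 * s ^+ 2 / 2))%:E)%E.
Proof.
move=> s0; rewrite ge0_integral_normal_prob//; last first.
  by apply/measurable_EFinP; apply: measurableT_comp => //;
    exact: measurable_funM.
transitivity (\int[mu]_x ((expR (t ^+ 2 * s ^+ 2 / 2))%:E *
    (normal_pdf (t * s ^+ 2) s x)%:E))%E.
  apply: eq_integral => x _; rewrite -!EFinM !normal_pdfE//; congr EFin.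
  rewrite [in LHS]mulrCA [in RHS]mulrCA; congr (_ * _).
  rewrite /normal_fun -!expRD; congr expR.
  by rewrite subr0 -mulr_natr; field; rewrite s0.
rewrite ge0_integralZl ?integral_normal_pdf ?mule1//.
- by apply/measurable_EFinP; exact: measurable_normal_pdf.
- by move=> x _; rewrite lee_fin normal_pdf_ge0.
Qed.

Lemma expR_ge1Dx2 (x : R) : 0 <= x -> 1 + x + x ^+ 2 / 2 <= expR x.
Proof.
move=> x0; have -> : 1 + x + x ^+ 2 / 2 = series (exp_coeff x) 3.
  rewrite /series /= !big_nat_recr//= big_nil /exp_coeff/= !factS fact0.
  by rewrite add0r expr0 expr1 !muln1 !divr1.
apply: nondecreasing_cvgn_le; last exact: is_cvg_series_exp_coeff.
by apply/nondecreasing_series => n _ _; exact: exp_coeff_ge0.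
Qed.

(** With v = x / 2 this is exp v - exp (- v) >= 2 v, squared. *)
Lemma cosh_ge (x : R) : 2 + x ^+ 2 <= expR x + expR (- x).
Proof.
(* Both sides are even. *)
wlog x0 : x / 0 <= x.
  move=> H; have [/H//|/ltW x0] := leP 0 x.
  by have := H (- x); rewrite oppr_ge0 sqrrN opprK [expR (- x) + _]addrC; exact.
pose v := x / 2; have v0 : 0 <= v by rewrite divr_ge0.
have -> : x = v + v by rewrite /v; field.
rewrite opprD !expRD expRN.
have := expR_ge1Dx2 v0; have := expR_gt0 v.
move: (expR v) => a a0 av.
have : a * (a - 2 * v) >= 1.
  have -> : a * (a - 2 * v) = (a - v) ^+ 2 - v ^+ 2 by ring.
  have : 1 + v ^+ 2 / 2 <= a - v by lra.
  have : 0 <= v ^+ 2 by exact: sqr_ge0.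
  move: (a - v) (v ^+ 2) => p q; nra.
move=> h; have {}h : 2 * v <= a - a^-1.
  rewrite -(ler_pM2l a0) mulrBr divff ?gt_eqF//.
  by move: h; rewrite mulrBr; lra.
have : a * a^-1 = 1 by rewrite divff ?gt_eqF.
move: (a^-1) h => b h ab; nra.
Qed.

Lemma expR_le_inv (v : R) : v < 1 -> expR v <= (1 - v)^-1.
Proof.
move=> v1; rewrite -[leLHS]invrK lef_pV2 ?posrE ?invr_gt0 ?expR_gt0 ?subr_gt0//.
by rewrite -expRN expR_ge1Dx.
Qed.

(** The function k^2 v - k m of k is nonnegative near 0 and vanishes at 0, so
    its slope at 0 vanishes. *)
Lemma small_slope (v m : R) : 0 < v ->
  (forall k, k ^+ 2 * v <= 1 -> k * m <= k ^+ 2 * v) -> m = 0.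
Proof.
move=> v0 H; apply/eqP; rewrite -normr_eq0; apply: contraT => m0.
have m0' : 0 < `|m| by rewrite lt_neqAle eq_sym m0 normr_ge0.
have v1 : 0 < v + 1 by rewrite addr_gt0.
pose b := Num.min (v + 1)^-1 (`|m| / 2 / (v + 1)).
have b0 : 0 < b by rewrite lt_min invr_gt0 v1 !divr_gt0.
have bv1 : b * (v + 1) <= 1.
  by rewrite -ler_pdivlMr// div1r ge_min lexx.
have bv2 : b * (v + 1) <= `|m| / 2.
  by rewrite -ler_pdivlMr// ge_min lexx orbT.
have bv0 : 0 < b * v by rewrite mulr_gt0.
(* The slope is tested at k = b with the sign of m, where k m = b |m|. *)
have kE : (Num.sg m * b) ^+ 2 = b ^+ 2.
  by rewrite exprMn sqr_sg -normr_eq0 m0 mul1r.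
have := H (Num.sg m * b); rewrite kE expr2 -mulrA.
rewrite (mulrC (Num.sg m)) -mulrA -normrEsg ler_pM2l// => K.
have : `|m| <= b * v by apply: K; rewrite mulr_ile1 ?ltW//; lra.
by lra.
Qed.

End Gaussian.

(** * Mean squares and centred functions *)

Section MeanSquare.
Context (d : measure_display) (T : measurableType d) (R : realType).
Context (P : {measure set T -> \bar R}).
Implicit Types f g h y : T -> R.

(** The square of the L^2 norm, infinite outside L^2. *)
Definition msq f : \bar R := (\int[P]_w ((f w) ^+ 2)%:E)%E.

Lemma msq_ge0 f : (0 <= msq f)%E.
Proof. by apply: integral_ge0 => w _; rewrite lee_fin sqr_ge0. Qed.

Lemma measurable_EFin_sqr d' (T' : measurableType d') (f : T' -> R) :
  measurable_fun setT f -> measurable_fun setT (fun w => ((f w) ^+ 2)%:E).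
Proof. by move=> mf; apply/measurable_EFinP; exact: measurable_funX. Qed.

Lemma ler_sqr_norm (a b : R) : `|a| <= `|b| -> a ^+ 2 <= b ^+ 2.
Proof.
by move=> ab; rewrite -(real_normK (num_real a)) -(real_normK (num_real b))
  lerXn2r ?nnegrE.
Qed.

Lemma msq_le f g : measurable_fun setT f -> measurable_fun setT g ->
  (forall w, `|f w| <= `|g w|) -> (msq f <= msq g)%E.
Proof.
move=> mf mg fg; apply: ge0_le_integral => //.
- by move=> w _; rewrite lee_fin sqr_ge0.
- exact: measurable_EFin_sqr.
- exact: measurable_EFin_sqr.
- by move=> w _; rewrite lee_fin ler_sqr_norm.
Qed.

Lemma msq_ae f g : measurable_fun setT f -> measurable_fun setT g ->
  {ae P, forall w, f w = g w} -> msq f = msq g.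
Proof.
move=> mf mg fg; apply: ge0_ae_eq_integral => //.
- exact: measurable_EFin_sqr.
- exact: measurable_EFin_sqr.
- by move=> w _; rewrite lee_fin sqr_ge0.
- by move=> w _; rewrite lee_fin sqr_ge0.
by apply: filterS fg => w /= -> _.
Qed.

Lemma msqZ (c : R) f : measurable_fun setT f ->
  msq (fun w => c * f w) = ((c ^+ 2)%:E * msq f)%E.
Proof.
move=> mf; rewrite /msq -ge0_integralZl//.
- by apply: eq_integral => w _; rewrite exprMn EFinM.
- exact: measurable_EFin_sqr.
- by move=> w _; rewrite lee_fin sqr_ge0.
- by rewrite lee_fin sqr_ge0.
Qed.

Lemma msq_bounded_mul f g (M : R) : measurable_fun setT f ->
  measurable_fun setT g ->
  (forall w, `|g w| <= M) ->
    (msq (fun w => g w * f w)%R <= (M ^+ 2)%:E * msq f)%E.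
Proof.
move=> mf mg gM; rewrite -msqZ//; apply: msq_le.
- exact: measurable_funM.
- exact: measurable_funM.
by move=> w; rewrite !normrM ler_wpM2r// (le_trans (gM w))// ler_norm.
Qed.

(** Young's inequality: the difference of the two sides is e (a - b / e)^2. *)
Lemma sqrrD_le (e a b : R) : 0 < e ->
  (a + b) ^+ 2 <= (1 + e) * a ^+ 2 + (1 + e^-1) * b ^+ 2.
Proof.
move=> e0; rewrite -subr_ge0.
have -> : (1 + e) * a ^+ 2 + (1 + e^-1) * b ^+ 2 - (a + b) ^+ 2 =
  e * (a - e^-1 * b) ^+ 2 by field; rewrite gt_eqF.
by rewrite mulr_ge0 ?sqr_ge0// ltW.
Qed.

Lemma msqD f g (e : R) : 0 < e ->
  measurable_fun setT f -> measurable_fun setT g ->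
  (msq (fun w => f w + g w)%R <= (1 + e)%:E * msq f + (1 + e^-1)%:E * msq g)%E.
Proof.
move=> e0 mf mg; have e1 : 0 <= e^-1 by rewrite invr_ge0 ltW.
rewrite /msq -!ge0_integralZl//; last 6 first.
- exact: measurable_EFin_sqr.
- by move=> w _; rewrite lee_fin sqr_ge0.
- by rewrite lee_fin addr_ge0.
- exact: measurable_EFin_sqr.
- by move=> w _; rewrite lee_fin sqr_ge0.
- by rewrite lee_fin addr_ge0// ltW.
have mfc (c : R) (k : T -> R) : measurable_fun setT k ->
    measurable_fun setT (fun w : T => (c%:E * ((k w) ^+ 2)%:E)%E).
  by move=> mk; apply: measurable_funeM; exact: measurable_EFin_sqr.
rewrite -ge0_integralD//; last 4 first.
- by move=> w _; rewrite -EFinM lee_fin mulr_ge0 ?sqr_ge0// addr_ge0// ltW.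
- exact: mfc.
- by move=> w _; rewrite -EFinM lee_fin mulr_ge0 ?sqr_ge0// addr_ge0.
- exact: mfc.
apply: ge0_le_integral => //.
- by move=> w _; rewrite lee_fin sqr_ge0.
- by apply: measurable_EFin_sqr; exact: measurable_funD.
- by apply: emeasurable_funD; exact: mfc.
- by move=> w _; rewrite -!EFinM -EFinD lee_fin sqrrD_le.
Qed.

Lemma msqD2 f g : measurable_fun setT f -> measurable_fun setT g ->
  (msq (fun w => f w + g w)%R <= 2%:E * msq f + 2%:E * msq g)%E.
Proof. by move=> mf mg; have := msqD ltr01 mf mg; rewrite invr1. Qed.

Definition clip (M x : R) := Num.max (- M) (Num.min x M).

Lemma clip_le M x : 0 <= M -> `|clip M x| <= M.
Proof.
move=> M0; rewrite ler_norml /clip le_max lexx/= ge_max ge_min lexx orbT andbT.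
by rewrite ge0_cp.
Qed.

Lemma norm_clip M x : 0 <= M -> `|clip M x| = Num.min `|x| M.
Proof.
move=> M0; rewrite /clip; have [x0|x0] := leP 0 x.
  rewrite (ger0_norm x0) max_r ?ger0_norm ?le_min ?x0//.
  by rewrite !(le_trans _ x0)//= ?oppr_le0// (le_trans _ M0)// oppr_le0.
rewrite (min_l (ltW (lt_le_trans x0 M0))) (ltr0_norm x0).
by rewrite -[x in Num.max _ x]opprK -oppr_min normrN ger0_norm// 1?minC//
  le_min M0 oppr_ge0 ltW.
Qed.

Lemma measurable_clip d' (T' : measurableType d') (M : R) (f : T' -> R) :
  measurable_fun setT f -> measurable_fun setT (fun w => clip M (f w)).
Proof. by move=> mf; apply: measurable_maxr => //; exact: measurable_minr. Qed.

(** Monotone convergence along the truncations of y. *)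
Lemma msq_clip f y (C : \bar R) : measurable_fun setT f ->
  measurable_fun setT y ->
  (forall M : R, 0 <= M -> (msq (fun w => clip M (y w) * f w)%R <= C)%E) ->
  (msq (fun w => y w * f w)%R <= C)%E.
Proof.
move=> mf my H.
(* Along the integers, the squares of the truncations increase to the square
   of y. *)
pose g (n : nat) w : \bar R := ((clip n%:R (y w) * f w) ^+ 2)%:E.
have gE n w : g n w = ((Num.min `|y w| n%:R) ^+ 2 * f w ^+ 2)%:E.
  by rewrite /g exprMn -norm_clip// real_normK// num_real.
have lim_g w : limn (g ^~ w) = ((y w * f w) ^+ 2)%:E.
  apply/cvg_lim => //; apply: cvg_near_cst.
  near=> n; rewrite gE min_l; first by rewrite exprMn real_normK// num_real.
  by near: n; exact: nbhs_infty_ger.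
rewrite /msq; under eq_integral do rewrite -lim_g.
rewrite monotone_convergence//.
- apply: lime_le; last by apply: nearW => n; exact: H.
  apply: ereal_nondecreasing_is_cvgn => m n mn.
  apply: ge0_le_integral => //.
  - by move=> w _; rewrite lee_fin sqr_ge0.
  - by apply: measurable_EFin_sqr; apply: measurable_funM => //;
    exact: measurable_clip.
  - by apply: measurable_EFin_sqr; apply: measurable_funM => //;
    exact: measurable_clip.
  - move=> w _; rewrite !gE lee_fin ler_wpM2r ?sqr_ge0// lerXn2r ?nnegrE
    ?le_min ?normr_ge0 ?ler0n//.
    by rewrite ge_min lexx/= ge_min ler_nat mn orbT.
- by move=> n; apply: measurable_EFin_sqr; apply: measurable_funM => //;
  exact: measurable_clip.
- by move=> n w _; rewrite lee_fin sqr_ge0.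
- move=> w _ m n mn; rewrite !gE lee_fin ler_wpM2r ?sqr_ge0// lerXn2r ?nnegrE
  ?le_min ?normr_ge0 ?ler0n//.
  by rewrite ge_min lexx/= ge_min ler_nat mn orbT.
Unshelve. all: by end_near. Qed.

(** The constants for which Young's inequality shows that the mean square is
    lower semicontinuous under L^2 convergence. *)
Lemma lim_constants (r dl : R) : 0 <= r -> 0 < dl ->
  exists eta e : R, [/\ 0 < eta, 0 < e &
    (1 + eta) * (r + e) + (1 + eta^-1) * e <= r + dl].
Proof.
(* With eta (r + 1) = dl / 2, the terms in e alone have to stay below dl / 2. *)
move=> r0 dl0; pose eta := dl / (2 * (r + 1)).
have eta0 : 0 < eta by rewrite divr_gt0// mulr_gt0// ltr_wpDl.
pose e := Num.min 1 (dl / 2 / (2 + eta^-1)).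
have ei : 0 < 2 + eta^-1 by rewrite addr_gt0// invr_gt0.
have e0 : 0 < e by rewrite lt_min ltr01 divr_gt0// divr_gt0.
exists eta, e; split => //.
have e1 : e <= 1 by rewrite ge_min lexx.
have e2 : (2 + eta^-1) * e <= dl / 2.
  by rewrite mulrC -ler_pdivlMr// ge_min lexx orbT.
have e3 : eta * (r + 1) = dl / 2 by rewrite /eta; field;
  rewrite gt_eqF// ltr_wpDl.
have : eta * e <= eta * 1 by rewrite ler_wpM2l// ltW.
by move: e2; rewrite mulrDl; lra.
Qed.

Lemma msq_lim f (C : \bar R) : (0 <= C)%E -> measurable_fun setT f ->
  (forall e : R, 0 < e -> exists g, [/\ measurable_fun setT g,
     (msq (fun w => f w - g w)%R <= e%:E)%E & (msq g <= C + e%:E)%E]) ->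
  (msq f <= C)%E.
Proof.
case: C => [r| |]//; first last.
  by move=> *; rewrite leey.
rewrite lee_fin => r0 mf H; apply/lee_addgt0Pr => dl dl0.
have [eta [e [eta0 e0 le]]] := lim_constants r0 dl0.
have [g [mg fg gC]] := H _ e0.
have -> : f = (fun w => g w + (f w - g w)) by apply/funext => w; rewrite subrKC.
apply: le_trans (msqD eta0 mg (measurable_funB mf mg)) _.
apply: (@le_trans _ _ ((1 + eta)%:E * (r + e)%:E + (1 + eta^-1)%:E * e%:E)%E).
  by apply: leeD; apply: lee_wpmul2l => //; rewrite lee_fin addr_ge0// ?invr_ge0
    ltW.
by rewrite -!EFinM -!EFinD lee_fin.
Qed.

(** The integrability makes the second condition meaningful. *)
Definition mean0 f :=
  P.-integrable setT (EFin \o f) /\ (\int[P]_w (f w)%:E = 0)%E.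

(** The Pythagorean inequality. *)
Lemma msqD_orth f g : measurable_fun setT f -> measurable_fun setT g ->
  (msq f < +oo)%E -> (msq g < +oo)%E -> mean0 (fun w => f w * g w) ->
  (msq (fun w => f w + g w)%R <= msq f + msq g)%E.
Proof.
move=> mf mg foo goo [fgi fg0].
have i2 h : measurable_fun setT h -> (msq h < +oo)%E ->
    P.-integrable setT (fun w => ((h w) ^+ 2)%:E).
  move=> mh hoo; apply/integrableP; split; first exact: measurable_EFin_sqr.
  by under eq_integral do rewrite gee0_abs ?lee_fin ?sqr_ge0//.
have if2 := i2 _ mf foo; have ig2 := i2 _ mg goo.
rewrite /msq; under eq_integral do rewrite sqrrD -addrA addrCA EFinD -mulr_natl
  EFinM.
rewrite integralD//; last 2 first.
- exact: (integrableZl measurableT 2 fgi).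
- under eq_fun do rewrite EFinD; exact: integrableD.
rewrite integralZl// fg0 mule0 add0e.
by under eq_integral do rewrite EFinD; rewrite integralD.
Qed.

Lemma mean0_0 : mean0 (fun=> 0).
Proof.
split; last by rewrite integral0_eq.
by rewrite (_ : _ \o _ = cst 0%E)//; exact: integrable0.
Qed.

Lemma mean0Z (c : R) f : mean0 f -> mean0 (fun w => c * f w).
Proof.
move=> [fi f0]; split; first exact: (integrableZl measurableT c fi).
by under eq_integral do rewrite EFinM; rewrite integralZl// f0 mule0.
Qed.

Lemma mean0D f g : mean0 f -> mean0 g -> mean0 (fun w => f w + g w).
Proof.
move=> [fi f0] [gi g0]; split; first exact: (integrableD measurableT fi gi).
by under eq_integral do rewrite EFinD; rewrite integralD// f0 g0 adde0.
Qed.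

Lemma mean0_lim f : measurable_fun setT f ->
  (forall e : R, 0 < e -> exists2 g, mean0 g &
     (\int[P]_w `|f w - g w|%:E <= e%:E)%E) -> mean0 f.
Proof.
move=> mf H.
have fgi g e : mean0 g -> (\int[P]_w `|f w - g w|%:E <= e%:E)%E ->
    P.-integrable setT (EFin \o (fun w => f w - g w)).
  move=> [gi g0] fge; apply/integrableP; split.
    apply/measurable_EFinP; apply: measurable_funB => //.
    by apply/measurable_EFinP; exact: measurable_int gi.
  by rewrite (le_lt_trans fge)// ltry.
have fE g : f = (fun w => g w + (f w - g w)) by apply/funext => w;
  rewrite subrKC.
split.
  have [g mg fge] := H _ ltr01; have [gi g0] := mg.
  by rewrite (fE g); exact: (integrableD measurableT gi (fgi _ _ mg fge)).
apply/eqP; rewrite -abse_eq0 eq_le abse_ge0 andbT.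
apply/lee_addgt0Pr => e e0; rewrite add0e.
have [g mg fge] := H _ e0; have [gi g0] := mg; have fi := fgi _ _ mg fge.
have -> : (\int[P]_w (f w)%:E = \int[P]_w (f w - g w)%:E)%E.
  transitivity (\int[P]_w ((g w)%:E + (f w - g w)%:E))%E.
    by apply: eq_integral => w _; rewrite -EFinD subrKC.
  by rewrite integralD// g0 add0e.
by apply: le_trans fge; exact: (le_abse_integral P measurableT
  (measurable_int _ fi)).
Qed.

Lemma L1_le_msq f h (c : R) : 0 < c ->
  measurable_fun setT f -> measurable_fun setT h ->
  (\int[P]_w `|f w * h w|%:E <= c%:E * msq f + c^-1%:E * msq h)%E.
Proof.
move=> c0 mf mh; have ci0 : 0 < c^-1 by rewrite invr_gt0.
rewrite /msq -!ge0_integralZl//; last 6 first.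
- exact: measurable_EFin_sqr.
- by move=> w _; rewrite lee_fin sqr_ge0.
- by rewrite lee_fin ltW.
- exact: measurable_EFin_sqr.
- by move=> w _; rewrite lee_fin sqr_ge0.
- by rewrite lee_fin ltW.
have mfc (e : R) (k : T -> R) : measurable_fun setT k ->
    measurable_fun setT (fun w : T => (e%:E * ((k w) ^+ 2)%:E)%E).
  by move=> mk; apply: measurable_funeM; exact: measurable_EFin_sqr.
rewrite -ge0_integralD//; last 4 first.
- by move=> w _; rewrite -EFinM lee_fin mulr_ge0 ?sqr_ge0// ltW.
- exact: mfc.
- by move=> w _; rewrite -EFinM lee_fin mulr_ge0 ?sqr_ge0// ltW.
- exact: mfc.
apply: ge0_le_integral => //.
- apply/measurable_EFinP; apply: measurableT_comp => //; exact: measurable_funM.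
- by apply: emeasurable_funD; exact: mfc.
move=> w _; rewrite -!EFinM -EFinD lee_fin.
move: (f w) (h w) => a b; rewrite normrM.
rewrite -(real_normK (num_real a)) -(real_normK (num_real b)).
move: `|a| `|b| (normr_ge0 a) (normr_ge0 b) => x y x0 y0.
have : 0 <= c * (x - c^-1 * y) ^+ 2 by rewrite mulr_ge0 ?sqr_ge0// ltW.
have -> : c * (x - c^-1 * y) ^+ 2 = c * x ^+ 2 + c^-1 * y ^+ 2 - 2 * (x * y).
  by field; rewrite gt_eqF.
have := mulr_ge0 x0 y0; lra.
Qed.

(** Centredness survives an L^2 limit in one factor, by Young's inequality
    with a parameter adapted to the size of the other factor. *)
Lemma mean0_lim_mul f h : measurable_fun setT f -> measurable_fun setT h ->
  (msq h < +oo)%E ->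
  (forall e : R, 0 < e -> exists g, [/\ measurable_fun setT g,
     mean0 (fun w => g w * h w) & (msq (fun w => f w - g w)%R <= e%:E)%E]) ->
  mean0 (fun w => f w * h w).
Proof.
move=> mf mh hoo H; apply: mean0_lim; first exact: measurable_funM.
have [r r0 hr] : exists2 r : R, 0 <= r & msq h = r%:E.
  have := msq_ge0 h; case: (msq h) hoo => [r| |]// _; exists r => //.
move=> e e0; pose c := 2 * (r + 1) / e.
have c0 : 0 < c by rewrite divr_gt0// mulr_gt0// ltr_wpDl.
have [|g [mg g0 fg]] := H (c^-1 * (e / 2)); first by rewrite mulr_gt0
  ?divr_gt0// invr_gt0.
exists (fun w => g w * h w) => //.
under eq_integral do rewrite -mulrBl.
apply: le_trans (L1_le_msq c0 (measurable_funB mf mg) mh) _; rewrite hr.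
apply: (@le_trans _ _ (c%:E * (c^-1 * (e / 2))%:E + c^-1%:E * r%:E)%E).
  by rewrite leeD2r//; apply: lee_wpmul2l => //; rewrite lee_fin ltW.
rewrite -!EFinM -EFinD lee_fin mulVKf ?gt_eqF//.
have : c^-1 * (r + 1) = e / 2.
  by rewrite /c; field; rewrite !gt_eqF// ltr_wpDl.
have : 0 < c^-1 by rewrite invr_gt0.
by rewrite mulrDr; lra.
Qed.

End MeanSquare.

Section MeanSquareProbability.
Context (d : measure_display) (T : measurableType d) (R : realType).
Context (P : probability T R).
Implicit Types f g : T -> R.

Lemma msq_cst (c : R) : msq P (fun=> c) = (c ^+ 2)%:E.
Proof. by rewrite /msq integral_cst//= probability_setT mule1. Qed.

Lemma mean0_lim_msq f : measurable_fun setT f ->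
  (forall e : R, 0 < e -> exists g, [/\ measurable_fun setT g,
     mean0 P g & (msq P (fun w => f w - g w)%R <= e%:E)%E]) ->
  mean0 P f.
Proof.
move=> mf H; have -> : f = (fun w => f w * cst 1 w) by apply/funext => w /=;
  rewrite mulr1.
apply: mean0_lim_mul => //; first by rewrite msq_cst ltry.
move=> e /H[g [mg g0 fg]]; exists g; split => //.
by under eq_fun do rewrite mulr1.
Qed.

End MeanSquareProbability.

(** * Products of independent variables *)

(** Independence of Z and D, stated on rectangles, says that the law of the
    pair is the product law; Fubini then splits expectations of products. *)
Section Independence.
Context (d : measure_display) (T : measurableType d) (R : realType).
Context (P : probability T R).
Variables Z D : T -> R.
Hypothesis mZ : measurable_fun setT Z.
Hypothesis mD : measurable_fun setT D.
Hypothesis ZD : forall A B : set R, measurable A -> measurable B ->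
  P (Z @^-1` A `&` D @^-1` B) = (P (Z @^-1` A) * P (D @^-1` B))%E.

Let Zm : {mfun T >-> R} := HB.pack Z (isMeasurableFun.Build _ _ _ _ _ mZ).
Let Dm : {mfun T >-> R} := HB.pack D (isMeasurableFun.Build _ _ _ _ _ mD).
Let ZDm : {mfun T >-> (R * R)%type} := HB.pack (fun w => (Z w, D w))
  (isMeasurableFun.Build _ _ _ _ _ (measurable_fun_pair mZ mD)).

Let product_law (X : set (R * R)) : measurable X ->
  (distribution P Zm \x distribution P Dm)%E X = distribution P ZDm X.
Proof.
apply: product_measure_unique => A B mA mB.
by rewrite /distribution /pushforward /= -ZD.
Qed.

Lemma msqM_indep : msq P (fun w => Z w * D w) = (msq P Z * msq P D)%E.
Proof.
pose f (p : R * R) : \bar R := ((p.1 * p.2) ^+ 2)%:E.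
have mf : measurable_fun setT f.
  by apply: measurable_EFin_sqr; exact: measurable_funM.
have f0 p : (0 <= f p)%E by rewrite lee_fin sqr_ge0.
have m2 : measurable_fun [set: R] (fun x : R => (x ^+ 2)%:E).
  exact: measurable_EFin_sqr.
have E0 (x : R) : (0 <= (x ^+ 2)%:E)%E by rewrite lee_fin sqr_ge0.
transitivity (\int[distribution P ZDm]_p f p)%E.
  by rewrite ge0_integral_distribution.
rewrite -(eq_measure_integral _ (fun A mA _ => product_law mA)).
rewrite fubini_tonelli1// /fubini_F.
have -> : msq P Z = (\int[distribution P Zm]_x (x ^+ 2)%:E)%E.
  by rewrite ge0_integral_distribution.
have -> : msq P D = (\int[distribution P Dm]_x (x ^+ 2)%:E)%E.
  by rewrite ge0_integral_distribution.
rewrite -ge0_integralZr//; last by apply: integral_ge0.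
apply: eq_integral => x _; rewrite -ge0_integralZl//.
by apply: eq_integral => y _; rewrite /f exprMn EFinM.
Qed.

Lemma mean0M_indep : (msq P Z < +oo)%E -> (msq P D < +oo)%E -> mean0 P D ->
  mean0 P (fun w => Z w * D w).
Proof.
move=> Zoo Doo [Di D0].
have Pi : P.-integrable setT (EFin \o (fun w => Z w * D w)).
  apply/integrableP; split; first by apply/measurable_EFinP;
    exact: measurable_funM.
  apply: le_lt_trans (L1_le_msq P ltr01 mZ mD) _.
  by rewrite invr1 !mul1e lte_add_pinfty.
split=> //.
pose f (p : R * R) : \bar R := (p.1 * p.2)%:E.
have mf : measurable_fun setT f.
  by apply/measurable_EFinP; exact: measurable_funM.
have mE : measurable_fun [set: R] (fun x : R => x%:E) by exact/measurable_EFinP.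
transitivity (\int[distribution P ZDm]_p f p)%E.
  by rewrite integral_distribution.
rewrite -(eq_measure_integral _ (fun A mA _ => product_law mA)).
rewrite -integral12_prod_meas1; last first.
  apply/integrableP; split => //.
  rewrite (eq_measure_integral _ (fun A mA _ => product_law mA)).
  rewrite ge0_integral_distribution//; last exact: measurableT_comp.
  by have /integrableP[] := Pi.
rewrite /fubini_F integral0_eq// => x _.
rewrite /f; under eq_integral do rewrite EFinM.
rewrite integralZl//; last exact: integrable_pushforward.
by rewrite integral_distribution// D0 mule0.
Qed.

End Independence.

(** * The past of the Wiener process and its increments *)

Section Past.
Context (d : measure_display) (T : measurableType d) (R : realType).
Context (P : probability T R) (W : R -> {RV P >-> R}).

Lemma past_sub_measurable (t : R) (A : set T) : past W t A -> measurable A.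
Proof.
apply: smallest_sub; first exact: sigma_algebra_measurable.
by move=> _ [u _ [B mB <-]]; rewrite setTI; exact: measurable_funPTI.
Qed.

Lemma past_mono (s t : R) : s <= t -> past W s `<=` past W t.
Proof.
move=> st; apply: sub_sigma_algebra2; apply: bigcup_subset => u /=.
by rewrite !in_itv/= => /andP[-> /le_trans]; exact.
Qed.

(** This form gives access to the closure properties of measurable functions. *)
Lemma past_measurableP (t : R) (X : T -> R) : past_measurable W t X <->
  measurable_fun setT (X : g_sigma_algebraType (\bigcup_(u in `[0%R, t])
    preimage_set_system setT (W u) measurable) -> R).
Proof.
split=> [H _ B mB|H B mB]; first by rewrite setTI; exact: H.
by have := H measurableT B mB; rewrite setTI.
Qed.

Lemma past_measurable_fun (t : R) (X : T -> R) :
  past_measurable W t X -> measurable_fun setT X.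
Proof.
by move=> H _ B mB; rewrite setTI; apply: past_sub_measurable; exact: H.
Qed.

Lemma past_measurable_mono (s t : R) (X : T -> R) : s <= t ->
  past_measurable W s X -> past_measurable W t X.
Proof. by move=> st H B mB; apply: (past_mono st); exact: H. Qed.

Lemma past_measurable_W (u t : R) : 0 <= u -> u <= t ->
  past_measurable W t (W u).
Proof.
move=> u0 ut B mB; apply: sub_sigma_algebra; exists u => /=.
  by rewrite in_itv/= u0.
by exists B => //; rewrite setTI.
Qed.

Lemma past_measurable_cst (t c : R) : past_measurable W t (fun=> c).
Proof. by apply/past_measurableP; exact: measurable_cst. Qed.

Lemma past_measurableD (t : R) (X Y : T -> R) : past_measurable W t X ->
  past_measurable W t Y -> past_measurable W t (fun w => X w + Y w).
Proof.
by move=> /past_measurableP mX /past_measurableP mY; apply/past_measurableP;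
  exact: measurable_funD.
Qed.

Lemma past_measurableB (t : R) (X Y : T -> R) : past_measurable W t X ->
  past_measurable W t Y -> past_measurable W t (fun w => X w - Y w).
Proof.
by move=> /past_measurableP mX /past_measurableP mY; apply/past_measurableP;
  exact: measurable_funB.
Qed.

Lemma past_measurableM (t : R) (X Y : T -> R) : past_measurable W t X ->
  past_measurable W t Y -> past_measurable W t (fun w => X w * Y w).
Proof.
by move=> /past_measurableP mX /past_measurableP mY; apply/past_measurableP;
  exact: measurable_funM.
Qed.

Lemma past_measurable_clip (t M : R) (X : T -> R) : past_measurable W t X ->
  past_measurable W t (fun w => clip M (X w)).
Proof.
by move=> /past_measurableP mX; apply/past_measurableP; exact: measurable_clip.
Qed.

Hypothesis HW : wiener_process W.

Definition incr (s t : R) (w : T) : R := W t w - W s w.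

Lemma measurable_incr s t : measurable_fun setT (incr s t).
Proof. by apply: measurable_funB. Qed.

Lemma ge0_integral_incr (s t : R) (f : R -> \bar R) : 0 <= s -> s < t ->
  measurable_fun setT f -> (forall x, 0 <= f x)%E ->
  (\int[P]_w f (incr s t w) = \int[normal_prob 0 (Num.sqrt (t - s))]_x f x)%E.
Proof.
move=> s0 st mf f0.
(* The law lives on the Borel line that carries the Lebesgue measure *)
have mi : measurable_fun setT (incr s t : T -> measurableTypeR R).
  exact: measurable_incr.
pose Dm : {mfun T >-> measurableTypeR R} := HB.pack (incr s t : T ->
  measurableTypeR R)
  (isMeasurableFun.Build _ _ _ _ _ mi).
transitivity (\int[distribution P Dm]_x f x)%E.
  by rewrite ge0_integral_distribution.
apply: (eq_measure_integral (normal_prob 0 (Num.sqrt (t - s)))) => B mB _.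
exact: (wiener_gauss HW).
Qed.

Lemma integral_expR_incr (s t k : R) : 0 <= s -> s < t ->
  (\int[P]_w (expR (k * incr s t w))%:E = (expR (k ^+ 2 * (t - s) / 2))%:E)%E.
Proof.
move=> s0 st; rewrite (ge0_integral_incr s0 st (f := fun x =>
  (expR (k * x))%:E)).
- by rewrite integral_normal_prob_expR ?gt_eqF ?sqrtr_gt0 ?subr_gt0//
  sqr_sqrtr// subr_ge0 ltW.
- by apply/measurable_EFinP; apply: measurableT_comp => //;
  exact: measurable_funM.
- by move=> x; rewrite lee_fin expR_ge0.
Qed.

Lemma incr_refl s w : incr s s w = 0.
Proof. exact: subrr. Qed.

(** Integrating k^2 x^2 + 2 <= exp (k x) + exp (- k x) against the law of the
    increment bounds its second moment by 2 (exp (k^2 v / 2) - 1) / k^2, which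
    tends to the variance v as k tends to 0. *)
Lemma msq_incr (s t : R) : 0 <= s -> s <= t ->
  (msq P (incr s t) <= (t - s)%:E)%E.
Proof.
move=> s0; rewrite le_eqVlt => /predU1P[<-|st].
  rewrite subrr (_ : incr s s = fun=> 0) ?msq_cst ?expr0n//.
  by apply/funext => w; exact: incr_refl.
have v0 : 0 < t - s by rewrite subr_gt0.
have key (k : R) : 0 < k -> k ^+ 2 * (t - s) / 2 < 1 ->
    (msq P (incr s t) <= ((t - s) / (1 - k ^+ 2 * (t - s) / 2))%:E)%E.
  move=> k0 k1.
  have mE c : measurable_fun setT (fun w => (expR (c * incr s t w))%:E).
    apply/measurable_EFinP; apply: measurableT_comp => //.
    by apply: measurable_funM => //; exact: measurable_incr.
  have H : (2%:E + (k ^+ 2)%:E * msq P (incr s t) <=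
      (expR (k ^+ 2 * (t - s) / 2))%:E + (expR (k ^+ 2 * (t - s) / 2))%:E)%E.
    have E1 := integral_expR_incr k s0 st.
    have E2 := integral_expR_incr (- k) s0 st; rewrite sqrrN in E2.
    rewrite -[in X in (_ <= _ + X)%E]E2 -E1.
    rewrite -msqZ; last exact: measurable_incr.
    rewrite -(_ : \int[P]_w 2%:E = 2%:E)%E; last first.
      by rewrite integral_cst//= probability_setT mule1.
    rewrite -!ge0_integralD//; last 2 first.
    - by move=> w _; rewrite lee_fin sqr_ge0.
    - by apply: measurable_EFin_sqr; apply: measurable_funM => //;
      exact: measurable_incr.
    apply: ge0_le_integral => //.
    - by move=> w _; rewrite -EFinD lee_fin addr_ge0 ?sqr_ge0.
    - by apply: emeasurable_funD => //; apply: measurable_EFin_sqr;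
      apply: measurable_funM => //; exact: measurable_incr.
    - by apply: emeasurable_funD.
    - by move=> w _; rewrite -!EFinD lee_fin mulNr cosh_ge.
  have := expR_le_inv k1.
  have k2 : 0 < k ^+ 2 by rewrite exprn_gt0.
  move: (msq_ge0 P (incr s t)) H; case: (msq P _) => [r| |]//; last first.
    by rewrite gt0_muley ?lte_fin// => _; rewrite -EFinD leye_eq.
  rewrite lee_fin -EFinM -!EFinD !lee_fin => r0 H1 H2.
  rewrite -(ler_pM2l k2) mulrA; move: H1 H2 k1.
  have -> : k ^+ 2 * (t - s) = 2 * (k ^+ 2 * (t - s) / 2) by field.
  move: (k ^+ 2 * (t - s) / 2) => x; rewrite (_ : 2 * x / 2 = x); last by field.
  move=> H1 H2 x1.
  have -> : 2 * x / (1 - x) = 2 * (1 - x)^-1 - 2.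
    by field; rewrite gt_eqF// subr_gt0.
  by move: H1 H2; move: (expR _) => e; lra.
apply/lee_addgt0Pr => e e0.
(* The value q of k^2 (t - s) / 2 for which the bound (t - s) / (1 - q) is
   exactly t - s + e. *)
pose q := e / (t - s + e).
have te : 0 < t - s + e by rewrite addr_gt0.
have q0 : 0 < q by rewrite divr_gt0.
have q1 : q < 1 by rewrite ltr_pdivrMr// mul1r ltrDr.
have qE : (t - s) / (1 - q) = t - s + e.
  by rewrite /q; field; rewrite gt_eqF//=; lra.
clearbody q; pose k := Num.sqrt (2 * q / (t - s)).
have qv : 0 < 2 * q / (t - s) by rewrite divr_gt0// mulr_gt0.
have kk : k ^+ 2 * (t - s) / 2 = q.
  by rewrite sqr_sqrtr ?(ltW qv)//; field; rewrite gt_eqF.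
by have := key k; rewrite kk sqrtr_gt0 qE -EFinD; exact.
Qed.

Lemma msq_incr_lty (s t : R) : 0 <= s -> s <= t -> (msq P (incr s t) < +oo)%E.
Proof. by move=> s0 st; rewrite (le_lt_trans (msq_incr s0 st))// ltry. Qed.

(** By 1 + k x <= exp (k x), the mean m satisfies 1 + k m <= exp (k^2 v / 2)
    for every k of either sign, so the slope m at k = 0 vanishes. *)
Lemma mean0_incr (s t : R) : 0 <= s -> s <= t -> mean0 P (incr s t).
Proof.
move=> s0 st'; have mi := measurable_incr s t.
have i1 : P.-integrable setT (EFin \o incr s t).
  apply/integrableP; split; first exact/measurable_EFinP.
  have := L1_le_msq P ltr01 mi (@measurable_cst _ _ T R setT 1).
  rewrite invr1 !mul1e msq_cst => H.
  under eq_integral do rewrite /= -[incr s t _]mulr1.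
  by rewrite (le_lt_trans H)// lte_add_pinfty ?ltry// msq_incr_lty.
split=> //.
move: st'; rewrite le_eqVlt => /predU1P[<-|st].
  by apply: integral0_eq => w _; rewrite incr_refl.
have v0 : 0 < t - s by rewrite subr_gt0.
have i1f := integrable_fin_num measurableT i1.
set m := (\int[P]_w _)%E in i1f *.
have key (k : R) : k ^+ 2 * (t - s) / 2 < 1 ->
    1 + k * fine m <= (1 - k ^+ 2 * (t - s) / 2)^-1.
  move=> k1; apply: le_trans (expR_le_inv k1).
  rewrite -lee_fin -integral_expR_incr// EFinD EFinM fineK//.
  rewrite /m -integralZl// -[1%E in leLHS](_ : \int[P]_w 1 = 1)%E; last first.
    by rewrite integral_cst//= probability_setT mule1.
  have c1 : P.-integrable setT (cst 1%E)
    by exact: finite_measure_integrable_cst.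
  have c2 : P.-integrable setT (fun w => k%:E * (incr s t w)%:E)%E
    by exact: (integrableZl measurableT k i1).
  rewrite -integralD//; apply: le_integral => //.
  - exact: integrableD.
  - apply/integrableP; split.
      apply/measurable_EFinP; apply: measurableT_comp => //.
      exact: measurable_funM.
    under eq_integral do rewrite gee0_abs ?lee_fin ?expR_ge0//.
    by rewrite integral_expR_incr// ltry.
  - by move=> w _; rewrite -EFinM -EFinD lee_fin expR_ge1Dx.
rewrite -(fineK i1f); congr EFin; apply: (small_slope v0) => k kv.
have x1 : k ^+ 2 * (t - s) / 2 < 1 by lra.
have := key k x1; rewrite -(ler_pM2r (_ : 0 < 1 - k ^+ 2 * (t - s) / 2))
  ?subr_gt0//.
rewrite mulVf ?gt_eqF ?subr_gt0//.
have : 0 <= k ^+ 2 * (t - s) by rewrite mulr_ge0 ?sqr_ge0// ltW.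
move: (k ^+ 2 * _) (k * _) kv => x y x1' x0; nra.
Qed.

End Past.

(** * Integrals of simple processes *)

Section SimpleIntegral.
Context (d : measure_display) (T : measurableType d) (R : realType).
Context (P : probability T R) (W : R -> {RV P >-> R}).
Hypothesis HW : wiener_process W.

Lemma past_incr_indep (s t : R) (Z : T -> R) : 0 <= s -> s < t ->
  past_measurable W s Z -> forall A B : set R, measurable A -> measurable B ->
  P (Z @^-1` A `&` (incr W s t) @^-1` B) =
  (P (Z @^-1` A) * P ((incr W s t) @^-1` B))%E.
Proof.
by move=> s0 st mZ A B mA mB; apply: (wiener_indep HW) => //; exact: mZ.
Qed.

Lemma msq_past_incr (s t : R) (Z : T -> R) : 0 <= s -> s <= t ->
  past_measurable W s Z ->
  (msq P (fun w => Z w * incr W s t w)%R <= (t - s)%:E * msq P Z)%E.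
Proof.
move=> s0 st'; have := st'; rewrite le_eqVlt => /predU1P[<- _|st mZ].
  rewrite subrr mul0e (_ : (fun w => _) = fun=> 0) ?msq_cst ?expr0n//.
  by apply/funext => w; rewrite incr_refl mulr0.
have mZ' := past_measurable_fun mZ.
rewrite (msqM_indep mZ' (@measurable_incr _ _ _ _ W s t)
  (past_incr_indep s0 st mZ)).
by rewrite muleC; apply: lee_wpmul2r; [exact: msq_ge0|exact: msq_incr].
Qed.

Lemma mean0_past_incr (s t : R) (Z : T -> R) : 0 <= s -> s <= t ->
  past_measurable W s Z -> (msq P Z < +oo)%E ->
  mean0 P (fun w => Z w * incr W s t w).
Proof.
move=> s0 st'; have := st'; rewrite le_eqVlt => /predU1P[<- _ _|st mZ Zoo].
  rewrite (_ : (fun w => _) = fun=> 0); last first.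
    by apply/funext => w; rewrite incr_refl mulr0.
  exact: mean0_0.
have mZ' := past_measurable_fun mZ.
apply: (mean0M_indep mZ' (@measurable_incr _ _ _ _ W s t)
  (past_incr_indep s0 st mZ)) => //.
- exact: msq_incr_lty.
- exact: mean0_incr.
Qed.

Variables (s t : R) (f : simple_process W s t).
Hypothesis s0 : 0 <= s.

Let tm := sp_time f.
Let c := sp_coef f.

Definition simple_partial (n : nat) (w : T) : R :=
  \sum_(i < n) c i w * incr W (tm i) (tm i.+1) w.

Lemma sp_time_homo i j : (i <= j)%N -> (j <= sp_size f)%N -> tm i <= tm j.
Proof.
elim: j => [|j IH]; first by rewrite leqn0 => /eqP ->.
rewrite leq_eqVlt => /predU1P[->//|ij] js.
by apply: le_trans (IH ij (ltnW js)) _; exact: sp_time_le.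
Qed.

Lemma sp_time_ge i : (i <= sp_size f)%N -> s <= tm i.
Proof. by move=> i_s; rewrite -(sp_time0 f); exact: sp_time_homo. Qed.

Lemma sp_time_le_end i : (i <= sp_size f)%N -> tm i <= t.
Proof. by move=> i_s; rewrite -(sp_timen f); exact: sp_time_homo. Qed.

Lemma simple_partialS n w : simple_partial n.+1 w =
  simple_partial n w + c n w * incr W (tm n) (tm n.+1) w.
Proof. by rewrite /simple_partial big_ord_recr. Qed.

(** The terms of the sum are orthogonal: each increment is independent of its
    coefficient and of all the previous terms. *)
Lemma simple_partialP n : (n <= sp_size f)%N ->
  [/\ past_measurable W (tm n) (simple_partial n), mean0 P (simple_partial n),
      (msq P (simple_partial n) < +oo)%E &
      (msq P (simple_partial n) <= \sum_(i < n) (tm i.+1 - tm i)%:E * msq P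
        (c i))%E].
Proof.
have [M cM] := sp_bounded f.
elim: n => [_|n IH ns].
  have -> : simple_partial 0 = fun=> 0.
    by apply/funext => w; rewrite /simple_partial big_ord0.
  rewrite msq_cst big_ord0 expr0n/=; split=> //.
  - exact: past_measurable_cst.
  - exact: mean0_0.
  - exact: ltry.
have [pS mS Soo Sle] := IH (ltnW ns).
have tn0 : 0 <= tm n := le_trans s0 (sp_time_ge (ltnW ns)).
have tnS : tm n <= tm n.+1 := sp_time_le ns.
have pc : past_measurable W (tm n) (c n) := sp_adapted ns.
have mc := past_measurable_fun pc.
have mpS := past_measurable_fun pS.
have cle (h : T -> R) : measurable_fun setT h ->
    (msq P (fun w => c n w * h w)%R <= (M ^+ 2)%:E * msq P h)%E.
  by move=> mh; apply: msq_bounded_mul => // w; exact: cM.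
have coo : (msq P (c n) < +oo)%E.
  have := cle (fun=> 1) (measurable_cst _); rewrite msq_cst expr1n mule1.
  under eq_fun do rewrite mulr1.
  by move=> h; rewrite (le_lt_trans h)// ltry.
pose D w := c n w * incr W (tm n) (tm n.+1) w.
have mD : measurable_fun setT D by apply: measurable_funM => //;
  exact: measurable_incr.
have DN : (msq P D <= (tm n.+1 - tm n)%:E * msq P (c n))%E
  by exact: msq_past_incr.
have Doo : (msq P D < +oo)%E.
  apply: le_lt_trans DN _; rewrite lte_mul_pinfty ?lee_fin ?subr_ge0//.
have D0 : mean0 P D by exact: mean0_past_incr.
have -> : simple_partial n.+1 = fun w => simple_partial n w + D w.
  by apply/funext => w; rewrite simple_partialS.
have pS1 : past_measurable W (tm n.+1) (fun w => simple_partial n w + D w).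
  apply: past_measurableD; first exact: past_measurable_mono pS.
  apply: past_measurableM; first exact: past_measurable_mono pc.
  apply: past_measurableB; apply: past_measurable_W => //.
  exact: le_trans tnS.
have SD : mean0 P (fun w => simple_partial n w * D w).
  under eq_fun do rewrite mulrA.
  apply: mean0_past_incr => //; first exact: past_measurableM.
  under eq_fun do rewrite mulrC.
  by apply: le_lt_trans (cle _ mpS) _; rewrite lte_mul_pinfty ?lee_fin ?sqr_ge0.
have ND := msqD_orth mpS mD Soo Doo SD.
split=> //; first exact: mean0D.
- by rewrite (le_lt_trans ND)// lte_add_pinfty.
- by rewrite big_ord_recr/=; apply: le_trans ND _; exact: leeD.
Qed.

Definition step_partial (n : nat) (p : measurableTypeR R * T) : R :=
  \sum_(i < n) c i p.2 * \1_(`]tm i, tm i.+1]%classic) p.1.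

Lemma measurable_step_term i : (i < sp_size f)%N ->
  measurable_fun setT (fun p : measurableTypeR R * T =>
    c i p.2 * \1_(`]tm i, tm i.+1]%classic) p.1 : R).
Proof.
move=> i_s; have mc := past_measurable_fun (sp_adapted i_s).
apply: measurable_funM.
  exact: (measurableT_comp mc measurable_snd).
apply: (measurableT_comp _ measurable_fst).
by apply: measurable_indic; exact: measurable_itv.
Qed.

Lemma measurable_step_partial n : (n <= sp_size f)%N ->
  measurable_fun setT (step_partial n).
Proof.
elim: n => [_|n IH ns].
  rewrite (_ : step_partial 0 = fun=> 0)//.
  by apply/funext => w; rewrite /step_partial big_ord0.
rewrite (_ : step_partial n.+1 = fun p => step_partial n p + c n p.2 * \1_(`]tm n, tm n.+1]%classic) p.1).
  by apply: measurable_funD;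
    [by apply: IH; exact: ltnW|exact: measurable_step_term].
by apply/funext => p; rewrite /step_partial big_ord_recr.
Qed.

Lemma step_partial0 n p : (n <= sp_size f)%N -> tm n < p.1 ->
  step_partial n p = 0.
Proof.
move=> ns np; rewrite /step_partial big1// => i _.
rewrite indicE memNset ?mulr0//= in_itv/= => /andP[_]; apply/negP;
  rewrite -ltNge.
by apply: le_lt_trans np; apply: sp_time_homo.
Qed.

Lemma msq_step_term i : (i < sp_size f)%N ->
  msq (lebesgue_measure \x P)%E (fun p : measurableTypeR R * T =>
    c i p.2 * \1_(`]tm i, tm i.+1]%classic) p.1 : R) =
  ((tm i.+1 - tm i)%:E * msq P (c i))%E.
Proof.
move=> i_s; rewrite /msq fubini_tonelli1; last 2 first.
- by apply: measurable_EFin_sqr; exact: measurable_step_term.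
- by move=> p; rewrite lee_fin sqr_ge0.
have mc := past_measurable_fun (sp_adapted i_s).
rewrite /fubini_F/=.
transitivity (\int[lebesgue_measure]_x
   (msq P (c i) * (\1_(`]tm i, tm i.+1]%classic) x)%:E))%E.
  apply: eq_integral => x _; rewrite muleC /msq -ge0_integralZl//.
  - apply: eq_integral => w _; rewrite -EFinM; congr EFin.
    by rewrite mulrC exprMn; congr (_ * _); rewrite indicE -natrX;
      case: (_ \in _).
  - exact: measurable_EFin_sqr.
  - by move=> w _; rewrite lee_fin sqr_ge0.
rewrite ge0_integralZl//; last 2 first.
- by apply/measurable_EFinP; apply: measurable_indic; exact: measurable_itv.
- exact: msq_ge0.
rewrite muleC integral_indic//= setIT lebesgue_measure_itv/= lte_fin.
case: ltP => // h.
suff -> : tm i.+1 - tm i = 0 by rewrite mul0e.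
by apply/eqP; rewrite subr_eq0 eq_le h; exact: sp_time_le.
Qed.

(** The steps have disjoint supports, so the square of the sum is the sum of
    the squares. *)
Lemma msq_step_partial n : (n <= sp_size f)%N ->
  msq (lebesgue_measure \x P)%E (step_partial n) =
  (\sum_(i < n) (tm i.+1 - tm i)%:E * msq P (c i))%E.
Proof.
elim: n => [_|n IH ns].
  rewrite big_ord0 /msq integral0_eq// => p _.
  by rewrite /step_partial big_ord0 expr0n.
rewrite big_ord_recr/= -IH ?(ltnW ns)// -msq_step_term// /msq -ge0_integralD//;
  last 4 first.
- by move=> w _; rewrite lee_fin sqr_ge0.
- by apply: measurable_EFin_sqr; by apply: measurable_step_partial; exact: ltnW.
- by move=> w _; rewrite lee_fin sqr_ge0.
- by apply: measurable_EFin_sqr; exact: measurable_step_term.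
apply: eq_integral => p _; rewrite -EFinD; congr EFin.
rewrite {1}/step_partial big_ord_recr/= -/(step_partial n p).
have [np|pn] := ltP (tm n) p.1.
  by rewrite step_partial0 ?(ltnW ns)// add0r expr0n add0r.
rewrite [X in _ + X ^+ 2](_ : _ = 0); first last.
  rewrite indicE memNset ?mulr0//= in_itv/= => /andP[]; rewrite ltNge pn//.
rewrite expr0n addr0; congr (_ ^+ 2).
rewrite indicE memNset ?mulr0 ?addr0//= in_itv/= => /andP[]; rewrite ltNge pn//.
Qed.

Lemma simple_value_supp r w :
  simple_value f r w * \1_(`[s, t]%classic) r = simple_value f r w.
Proof.
rewrite /simple_value mulr_suml; apply: eq_bigr => -[i i_s] _ /=.
rewrite -mulrA; congr (_ * _); rewrite !indicE -natrM mulnb; congr (_%:R).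
congr nat_of_bool; apply/andb_idr; rewrite !inE/= !in_itv/= => /andP[h1 h2].
rewrite (le_trans (sp_time_ge (ltnW i_s)) (ltW h1)).
by rewrite (le_trans h2 (sp_time_le_end i_s)).
Qed.

Lemma measurable_simple_integral : measurable_fun setT (simple_integral f).
Proof. by have [/past_measurable_fun] := simple_partialP (leqnn _). Qed.

Lemma past_simple_integral : past_measurable W t (simple_integral f).
Proof. by have [] := simple_partialP (leqnn _); rewrite /tm sp_timen. Qed.

Lemma mean0_simple_integral : mean0 P (simple_integral f).
Proof. by have [] := simple_partialP (leqnn _). Qed.

Lemma msq_simple_integral_lty : (msq P (simple_integral f) < +oo)%E.
Proof. by have [] := simple_partialP (leqnn _). Qed.

Lemma measurable_simple_value : measurable_fun setT
  (fun p : measurableTypeR R * T => simple_value f p.1 p.2).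
Proof. exact: (measurable_step_partial (leqnn _)). Qed.

(** One half of the Ito isometry; the upper bound is the half that controls
    moments. *)
Lemma msq_simple_integral : (msq P (simple_integral f) <=
  msq (lebesgue_measure \x P)%E
    (fun p : measurableTypeR R * T => simple_value f p.1 p.2))%E.
Proof.
have [_ _ _] := simple_partialP (leqnn _).
by rewrite -msq_step_partial.
Qed.

End SimpleIntegral.

(** * Ito integrals and integrals in time *)

Section ItoBounds.
Context (d : measure_display) (T : measurableType d) (R : realType).
Context (P : probability T R) (W : R -> {RV P >-> R}).
Hypothesis HW : wiener_process W.

Local Notation leb := (@lebesgue_measure R).
Local Notation PM := (leb \x P)%E.

(** Cutting X off outside [s, t] gives a function on the whole product space,
    where Tonelli applies. *)
Definition on_itv (s t : R) (X : R -> T -> R) (p : measurableTypeR R * T) : R :=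
  X p.1 p.2 * \1_(`[s, t]%classic) p.1.

Lemma msq_prodE12 (F : measurableTypeR R * T -> R) : measurable_fun setT F ->
  msq PM F = (\int[leb]_r msq P (fun w => F (r, w)))%E.
Proof.
move=> mF; rewrite /msq fubini_tonelli1//; first exact: measurable_EFin_sqr.
by move=> p; rewrite lee_fin sqr_ge0.
Qed.

Lemma msq_prodE21 (F : measurableTypeR R * T -> R) : measurable_fun setT F ->
  msq PM F = (\int[P]_w msq leb (fun r : measurableTypeR R => F (r, w)))%E.
Proof.
move=> mF; rewrite /msq fubini_tonelli2//; first exact: measurable_EFin_sqr.
by move=> p; rewrite lee_fin sqr_ge0.
Qed.

Lemma integral_on_itv (s t : R) (x : R -> R) (m : R -> R) : m 0 = 0 ->
  (\int[leb]_(r in `[s, t]) (m (x r))%:E =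
   \int[leb]_r (m (x r * \1_(`[s, t]%classic) r))%:E)%E.
Proof.
move=> m0; rewrite [LHS]integral_mkcond; apply: eq_integral => r _.
rewrite patchE indicE; case: ifP => _; first by rewrite mulr1.
by rewrite mulr0 m0.
Qed.

(** Approximation by simple processes in L^2 of the product measure, with one
    process for both conditions. *)
Definition ito_approx (X : R -> T -> R) (s t : R) (J : T -> R) : Prop :=
  forall e : R, 0 < e -> exists f : simple_process W s t,
    (msq PM (fun p => on_itv s t X p - simple_value f p.1 p.2)%R <= e%:E)%E /\
    (msq P (fun w => J w - simple_integral f w)%R <= e%:E)%E.

Lemma near_lt_cvg0 (u : nat -> \bar R) (e : R) : 0 < e ->
  u @ \oo --> 0%E -> \forall k \near \oo, (u k < e%:E)%E.
Proof.
move=> e0 u0; apply: (u0 [set y | (y < e%:E)%E]).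
apply: open_nbhs_nbhs; split; first exact: open_ereal_lt_ereal.
by rewrite /= lte_fin.
Qed.

(** Tonelli identifies the iterated integral with the integral over the
    product space. *)
Lemma ito_integral_approx (X : R -> T -> R) (s t : R) (J : T -> R) : 0 <= s ->
  measurable_fun setT (on_itv s t X) -> ito_integral W X s t J ->
  ito_approx X s t J.
Proof.
move=> s0 mX [f [f1 f2]] e e0.
have {}f2 : (fun k => msq P (fun w => J w - simple_integral (f k) w)) @ \oo -->
  0%E.
  by move: f2; rewrite unlock.
have sqE k : (\int[P]_w \int[leb]_(r in `[s, t])
      ((X r w - simple_value (f k) r w) ^+ 2)%:E)%E =
    msq PM (fun p => on_itv s t X p - simple_value (f k) p.1 p.2).
  rewrite msq_prodE21; last first.
    by apply: measurable_funB => //; exact: measurable_simple_value.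
  apply: eq_integral => w _.
  rewrite (integral_on_itv s t (fun r => X r w - simple_value (f k) r w)
    (m := fun x => x ^+ 2)) ?expr0n//.
  by apply: eq_integral => r _ /=; rewrite mulrBl simple_value_supp.
have {sqE}f1 : (fun k => msq PM
    (fun p => on_itv s t X p - simple_value (f k) p.1 p.2)) @ \oo --> 0%E.
  by under eq_fun do rewrite -sqE.
near \oo => k; exists (f k); split; apply: ltW; near: k; exact: near_lt_cvg0.
Unshelve. all: by end_near. Qed.

(** The isometry inequality passes to L^2 limits on both sides. *)
Lemma ito_msq (X : R -> T -> R) (s t : R) (J : T -> R) : 0 <= s ->
  measurable_fun setT (on_itv s t X) -> measurable_fun setT J ->
  ito_approx X s t J -> (msq P J <= msq PM (on_itv s t X))%E.
Proof.
move=> s0 mX mJ XJ; apply: msq_lim => //; first exact: msq_ge0.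
move=> e e0; have := msq_ge0 PM (on_itv s t X).
case E : (msq PM (on_itv s t X)) => [r| |]// r0; last first.
  have [f [_ f2]] := XJ _ e0; exists (simple_integral f); split => //.
    exact: measurable_simple_integral.
  by rewrite addye// leey.
have [eta [e' [eta0 e'0 le]]] := lim_constants r0 e0.
have m0 : 0 < Num.min e e' by rewrite lt_min e0.
have [f [f1 f2]] := XJ _ m0.
exists (simple_integral f); split => //.
- exact: measurable_simple_integral.
- by apply: le_trans f2 _; rewrite lee_fin ge_min lexx.
have mf := measurable_simple_value f.
apply: le_trans (msq_simple_integral HW f s0) _.
have -> : (fun p : measurableTypeR R * T => simple_value f p.1 p.2) =
    (fun p => on_itv s t X p + (simple_value f p.1 p.2 - on_itv s t X p)).
  by apply/funext => p; rewrite addrC subrK.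
apply: le_trans (msqD PM eta0 mX (measurable_funB mf mX)) _.
have -> : msq PM (fun p => simple_value f p.1 p.2 - on_itv s t X p) =
    msq PM (fun p => on_itv s t X p - simple_value f p.1 p.2).
  by apply: eq_integral => p _; rewrite -sqrrN opprB.
rewrite E; apply: (@le_trans _ _ ((1 + eta)%:E * r%:E + (1 + eta^-1)%:E *
  e'%:E)%E).
  apply: leeD => //; apply: lee_wpmul2l; first by rewrite lee_fin addr_ge0//
    invr_ge0 ltW.
  by apply: le_trans f1 _; rewrite lee_fin ge_min lexx orbT.
rewrite -!EFinM -!EFinD lee_fin; apply: le_trans le.
by rewrite lerD2r ler_wpM2l ?lerDl ?addr_ge0// ltW.
Qed.

Lemma ito_mean0 (X : R -> T -> R) (s t : R) (J : T -> R) : 0 <= s ->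
  measurable_fun setT J -> ito_approx X s t J -> mean0 P J.
Proof.
move=> s0 mJ XJ; apply: mean0_lim_msq => // e e0.
have [f [_ f2]] := XJ _ e0; exists (simple_integral f); split => //.
- exact: measurable_simple_integral.
- exact: mean0_simple_integral.
Qed.

Definition past_bounded (s : R) (g : T -> R) :=
  past_measurable W s g /\ exists M : R, forall w, `|g w| <= M.

Section Weight.
Variables (s t : R) (g : T -> R) (f : simple_process W s t).
Hypothesis gs : past_bounded s g.

Definition weighted_coef i w := g w * sp_coef f i w.

Lemma weighted_adapted i : (i < sp_size f)%N ->
  past_measurable W (sp_time f i) (weighted_coef i).
Proof.
move=> i_s; apply: past_measurableM; last exact: sp_adapted.
by apply: past_measurable_mono gs.1; apply: sp_time_ge; exact: ltnW.
Qed.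

Lemma weighted_bounded : exists M : R, forall i w, (i < sp_size f)%N ->
  `|weighted_coef i w| <= M.
Proof.
have [_ [M gM]] := gs; have [N fN] := sp_bounded f.
by exists (M * N) => i w i_s; rewrite normrM ler_pM// fN.
Qed.

(** Multiplying every coefficient by a past-measurable bounded factor keeps
    the process simple and adapted. *)
Definition weighted_process : simple_process W s t :=
  SimpleProcess (sp_time0 f) (sp_timen f) (@sp_time_le _ _ _ _ _ _ _ f)
    weighted_adapted weighted_bounded.

Lemma weighted_value r w :
  simple_value weighted_process r w = g w * simple_value f r w.
Proof.
by rewrite /simple_value mulr_sumr; apply: eq_bigr => i _; rewrite /= mulrA.
Qed.

Lemma weighted_integral w :
  simple_integral weighted_process w = g w * simple_integral f w.
Proof.
by rewrite /simple_integral mulr_sumr; apply: eq_bigr => i _; rewrite /= mulrA.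
Qed.
End Weight.

(** Known factors can be moved inside the integral; this turns mean square
    bounds into conditional ones. *)
Lemma ito_mul (X : R -> T -> R) (s t : R) (J g : T -> R) : 0 <= s ->
  measurable_fun setT (on_itv s t X) -> measurable_fun setT J ->
  past_bounded s g -> ito_approx X s t J ->
  ito_approx (fun r w => g w * X r w) s t (fun w => g w * J w).
Proof.
move=> s0 mX mJ gs XJ e e0; have [pg [M gM]] := gs.
have mg := past_measurable_fun pg.
have M1 : 0 < M ^+ 2 + 1 by rewrite ltr_wpDl// sqr_ge0.
have [f [f1 f2]] := XJ _ (divr_gt0 e0 M1).
have le0 : ((M ^+ 2)%:E * (e / (M ^+ 2 + 1))%:E <= e%:E)%E.
  rewrite -EFinM lee_fin mulrA ler_pdivrMr// mulrC ler_pM2l//; lra.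
exists (weighted_process f gs); split.
  rewrite (_ : (fun p => _) = (fun p : measurableTypeR R * T =>
    g p.2 * (on_itv s t X p - simple_value f p.1 p.2))); last first.
    by apply/funext => p; rewrite weighted_value /on_itv mulrBr mulrA.
  apply: le_trans (msq_bounded_mul _ (M := M) _ _ _) _.
  - by apply: measurable_funB => //; exact: measurable_simple_value.
  - exact: (measurableT_comp mg measurable_snd).
  - by move=> p; exact: gM.
  by apply: le_trans le0; apply: lee_wpmul2l => //; rewrite lee_fin sqr_ge0.
rewrite (_ : (fun p => _) = (fun w => g w * (J w - simple_integral f w)));
  last first.
  by apply/funext => w; rewrite weighted_integral mulrBr.
apply: le_trans (msq_bounded_mul _ (M := M) _ _ _) _ => //.
  by apply: measurable_funB => //; exact: measurable_simple_integral.
by apply: le_trans le0; apply: lee_wpmul2l => //; rewrite lee_fin sqr_ge0.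
Qed.

Definition past_closure (t : R) (f : T -> R) : Prop :=
  forall e : R, 0 < e -> exists2 g : T -> R, past_bounded t g &
    (msq P (fun w => f w - g w)%R <= e%:E)%E.

(** Truncation and dominated convergence. *)
Lemma past_closure_past (t : R) (f : T -> R) :
  past_measurable W t f -> (msq P f < +oo)%E -> past_closure t f.
Proof.
move=> pf foo e e0; have mf := past_measurable_fun pf.
have mfc n : measurable_fun setT (fun w => f w - clip n%:R (f w)).
  by apply: measurable_funB => //; exact: measurable_clip.
have mF n : measurable_fun setT (fun w => ((f w - clip n%:R (f w)) ^+ 2)%:E).
  exact: measurable_EFin_sqr.
have fcle n w : `|f w - clip n%:R (f w)| <= `|f w|.
  rewrite /clip; have n0 : 0 <= n%:R :> R by [].
  move: (n%:R) n0 (f w) => c c0 x.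
  have [xc|cx] := leP x c.
    have [cx|xc'] := leP (- c) x; first by rewrite subrr normr0.
    have x0 : x < 0 by rewrite (lt_le_trans xc')// oppr_le0.
    by rewrite ler0_norm ?ltr0_norm// ?opprB ?opprK; lra.
  have x0 : 0 < x by exact: le_lt_trans cx.
  rewrite max_r; last by lra.
  by rewrite (ger0_norm (ltW x0)) ger0_norm; lra.
have H1 : \forall w \ae P, [set: T] w ->
    ((f w - clip n%:R (f w)) ^+ 2)%:E @[n --> \oo] --> 0%E.
  apply: aeW => w _; apply: cvg_near_cst; near=> n.
  have nf : `|f w| <= n%:R by near: n; exact: nbhs_infty_ger.
  move: nf; rewrite ler_norml /clip => /andP[h1 h2].
  by rewrite min_l// max_r// subrr expr0n.
have H2 : P.-integrable setT (fun w => ((f w) ^+ 2)%:E).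
  apply/integrableP; split; first exact: measurable_EFin_sqr.
  by under eq_integral do rewrite gee0_abs ?lee_fin ?sqr_ge0//.
have H3 : \forall w \ae P, forall n, [set: T] w ->
    (`|((f w - clip n%:R (f w)) ^+ 2)%:E| <= ((f w) ^+ 2)%:E)%E.
  apply: aeW => w n _; rewrite gee0_abs ?lee_fin ?sqr_ge0//.
  exact: ler_sqr_norm.
have [_ _] := dominated_convergence measurableT mF (measurable_cst 0%E) H1 H2
  H3.
rewrite integral0 => cv.
have {}cv : (fun n => msq P (fun w => f w - clip n%:R (f w))) @ \oo --> 0%E
  by [].
near \oo => n; exists (fun w => clip n%:R (f w)).
  split; first exact: past_measurable_clip.
  by exists n%:R => w; rewrite clip_le.
by apply: ltW; near: n; exact: near_lt_cvg0.
Unshelve. all: by end_near. Qed.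

Lemma ito_closure (X : R -> T -> R) (s t : R) (J : T -> R) : 0 <= s ->
  measurable_fun setT J -> ito_approx X s t J -> past_closure t J.
Proof.
move=> s0 mJ XJ e e0; have e4 : 0 < e / 4 by rewrite divr_gt0.
have [f [_ f2]] := XJ _ e4.
have [g gt gf] := past_closure_past (past_simple_integral HW f s0)
  (msq_simple_integral_lty HW f s0) e4.
exists g => //.
have mf : measurable_fun setT (simple_integral f)
  by exact: measurable_simple_integral.
have mg := past_measurable_fun gt.1.
have -> : (fun w => J w - g w) =
    (fun w => (J w - simple_integral f w) + (simple_integral f w - g w)).
  by apply/funext => w; rewrite addrA subrK.
apply: le_trans (msqD2 P (measurable_funB mJ mf) (measurable_funB mf mg)) _.
apply: (@le_trans _ _ (2%:E * (e / 4)%:E + 2%:E * (e / 4)%:E)%E).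
  by apply: leeD; apply: lee_wpmul2l.
by rewrite -!EFinM -EFinD lee_fin; lra.
Qed.

(** A weight y that acts boundedly on the functions g acts boundedly on their
    L^2 limits. As y may be unbounded, it is truncated first: then y g is
    close to y f in L^2, with a bound that does not depend on the truncation.
    The factor 4 comes from two applications of (a + b)^2 <= 2 a^2 + 2 b^2. *)
Lemma past_closure_msqM (t K : R) (f y : T -> R) : 0 <= K ->
  measurable_fun setT f -> measurable_fun setT y -> (msq P f < +oo)%E ->
  (forall g, past_bounded t g ->
    (msq P (fun w => y w * g w)%R <= K%:E * msq P g)%E) ->
  past_closure t f -> (msq P (fun w => y w * f w)%R <= (4 * K)%:E * msq P f)%E.
Proof.
move=> K0 mf my foo yK cf; apply: msq_clip => // M M0.
have := msq_ge0 P f; case fE : (msq P f) foo => [r| |]// _ r0.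
rewrite -EFinM; apply/lee_addgt0Pr => e e0.
have D0 : 0 < 4 * K + 2 * M ^+ 2 + 1.
  by rewrite ltr_wpDl// addr_ge0// mulr_ge0// sqr_ge0.
have [g gt fg] := cf _ (divr_gt0 e0 D0).
have mg := past_measurable_fun gt.1.
have mc : measurable_fun setT (fun w => clip M (y w)) by exact: measurable_clip.
pose k := e / (4 * K + 2 * M ^+ 2 + 1); rewrite -/k in fg.
have k0 : 0 < k by rewrite divr_gt0.
have gN : (msq P g <= (2 * r + 2 * k)%:E)%E.
  have -> : g = (fun w => f w + (g w - f w)) by apply/funext => w;
    rewrite addrC subrK.
  apply: le_trans (msqD2 P mf (measurable_funB mg mf)) _.
  apply: (@le_trans _ _ (2%:E * r%:E + 2%:E * k%:E)%E);
    last by rewrite -!EFinM -EFinD.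
  rewrite fE; apply: leeD => //; apply: lee_wpmul2l => //.
  rewrite (_ : msq P _ = msq P (fun w => f w - g w))//.
  by apply: eq_integral => w _; rewrite -sqrrN opprB.
have -> : (fun w => clip M (y w) * f w) =
    (fun w => clip M (y w) * g w + clip M (y w) * (f w - g w)).
  by apply/funext => w; rewrite -mulrDr addrC subrK.
apply: le_trans (msqD2 P (measurable_funM mc mg) (measurable_funM mc
  (measurable_funB mf mg))) _.
apply: (@le_trans _ _ (2%:E * (K * (2 * r + 2 * k))%:E + 2%:E *
  (M ^+ 2 * k)%:E)%E).
  apply: leeD; apply: lee_wpmul2l => //.
    apply: (@le_trans _ _ (msq P (fun w => y w * g w))).
      apply: msq_le; [exact: measurable_funM|exact: measurable_funM|move=> w].
      by rewrite !normrM ler_wpM2r// norm_clip// ge_min lexx.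
    by apply: le_trans (yK _ gt) _; rewrite EFinM; apply: lee_wpmul2l;
      rewrite ?lee_fin.
  rewrite EFinM; apply: le_trans (msq_bounded_mul _ (M := M) _ _ _) _ => //.
  - exact: measurable_funB.
  - by move=> w; exact: clip_le.
  by apply: lee_wpmul2l => //; rewrite lee_fin sqr_ge0.
rewrite -!EFinM -!EFinD lee_fin.
have : k * (4 * K + 2 * M ^+ 2 + 1) = e by rewrite divfK// gt_eqF.
lra.
Qed.

Lemma past_closure_mean0M (s : R) (f J : T -> R) :
  measurable_fun setT f -> measurable_fun setT J -> (msq P J < +oo)%E ->
  (forall g, past_bounded s g -> mean0 P (fun w => g w * J w)) ->
  past_closure s f -> mean0 P (fun w => f w * J w).
Proof.
move=> mf mJ Joo H cf; apply: mean0_lim_mul => // e /cf[g gs fg].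
by exists g; split => //; [exact: past_measurable_fun gs.1|exact: H].
Qed.

(** The Cauchy-Schwarz inequality up to a constant, obtained from |int x| <= c
    int x^2 + (t - s) / c with the optimal order of c. *)
Lemma Rintegral_sqr_le (s t : R) (x : R -> R) : s <= t ->
  measurable_fun setT (fun r : measurableTypeR R =>
    x r * \1_(`[s, t]%classic) r : R) ->
  (((\int[leb]_(r in `[s, t]) x r)%R ^+ 2)%:E <=
   (4 * (t - s))%:E * msq leb (fun r : measurableTypeR R =>
     x r * \1_(`[s, t]%classic) r)%R)%E.
Proof.
rewrite le_eqVlt => /predU1P[<- _|st mx].
  by rewrite set_itv1 Rintegral_set1 expr0n/= subrr mulr0 mul0e.
have v0 : 0 < t - s by rewrite subr_gt0.
pose x1 (r : measurableTypeR R) : R := x r * \1_(`[s, t]%classic) r.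
pose o1 (r : measurableTypeR R) : R := \1_(`[s, t]%classic) r.
have mo : measurable_fun setT o1 by apply: measurable_indic;
  exact: measurable_itv.
have No : msq leb o1 = (t - s)%:E.
  rewrite /msq; under eq_integral do rewrite /o1 indicE -natrX.
  transitivity (\int[leb]_r (\1_(`[s, t]%classic) r)%:E)%E.
    by apply: eq_integral => r _; rewrite indicE; case: (_ \in _).
  by rewrite integral_indic//= setIT lebesgue_measure_itv/= lte_fin st -EFinB.
have IE : (\int[leb]_(r in `[s, t]) (x r)%:E = \int[leb]_r (x1 r)%:E)%E.
  by rewrite (integral_on_itv s t x (m := id)).
have B (c : R) : 0 < c ->
    (`|\int[leb]_r (x1 r)%:E| <= c%:E * msq leb x1 + c^-1%:E * (t - s)%:E)%E.
  move=> c0; rewrite -No.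
  apply: le_trans (L1_le_msq leb c0 mx mo).
  apply: (le_trans (le_abse_integral leb measurableT _));
    first exact/measurable_EFinP.
  apply: ge0_le_integral => //.
  - exact/measurable_EFinP/measurableT_comp.
  - by apply/measurable_EFinP; apply: measurableT_comp => //;
    exact: measurable_funM.
  move=> r _; rewrite /= lee_fin /x1 /o1 indicE.
  by case: (_ \in _); rewrite ?mulr1// !mulr0.
rewrite /Rintegral IE -/x1; have := msq_ge0 leb x1.
case: (msq leb x1) B => [q| |]// B q0; last first.
  by rewrite gt0_muley ?leey// lte_fin mulr_gt0.
move: B; case: (\int[leb]_r _)%E => [b| |] B /=; last 2 first.
- by rewrite expr0n -EFinM lee_fin !mulr_ge0// ltW.
- by rewrite expr0n -EFinM lee_fin !mulr_ge0// ltW.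
rewrite -EFinM lee_fin.
have {}B c : 0 < c -> `|b| <= c * q + c^-1 * (t - s).
  by move=> /B; rewrite -!EFinM -EFinD lee_fin.
rewrite -(real_normK (num_real b)).
have [->|b0] := eqVneq b 0; first by rewrite normr0 expr0n !mulr_ge0// ltW.
have {}b0 : 0 < `|b| by rewrite normr_gt0.
move: `|b| b0 B => a a0 B.
(* For this value of c the second term is a / 2. *)
have := B (2 * (t - s) / a); rewrite divr_gt0 ?mulr_gt0// => /(_ isT).
have -> : (2 * (t - s) / a)^-1 * (t - s) = a / 2.
  by field; rewrite !gt_eqF.
move=> h; have {}h : a * a <= a * (2 * (t - s) / a * q + a / 2)
  by rewrite ler_pM2l.
have e1 : a * (2 * (t - s) / a * q + a / 2) = 2 * (t - s) * q + a ^+ 2 / 2.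
  by field; rewrite gt_eqF.
move: h; rewrite e1 -expr2; lra.
Qed.

(** Cauchy-Schwarz on each path, then Tonelli; the factor y does not depend on
    time and goes through. *)
Lemma msq_dt (X : R -> T -> R) (s t : R) (J y : T -> R) : s <= t ->
  measurable_fun setT (on_itv s t X) -> measurable_fun setT J ->
  measurable_fun setT y ->
  {ae P, forall w, J w = (\int[leb]_(r in `[s, t]) X r w)%R} ->
  (msq P (fun w => y w * J w)%R <=
    (4 * (t - s))%:E * msq PM (on_itv s t (fun r w => y w * X r w)%R))%E.
Proof.
move=> st mX mJ my JX; have v0 : 0 <= 4 * (t - s) by rewrite mulr_ge0//
  subr_ge0.
have myX : measurable_fun setT (on_itv s t (fun r w => y w * X r w)).
  rewrite (_ : on_itv _ _ _ = fun p => y p.2 * on_itv s t X p).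
    by apply: measurable_funM => //;
      exact: (measurableT_comp my measurable_snd).
  by apply/funext => p; rewrite /on_itv mulrA.
have mG : measurable_fun setT (fun w => msq leb (fun r : measurableTypeR R =>
    on_itv s t (fun r w => y w * X r w) (r, w))).
  apply: (measurable_fun_fubini_tonelli_G (m1 := leb)
    (fun p => ((on_itv s t (fun r w => y w * X r w) p) ^+ 2)%:E)).
  - exact: measurable_EFin_sqr.
  - by move=> p; rewrite lee_fin sqr_ge0.
rewrite msq_prodE21// -ge0_integralZl//; last first.
  by move=> w _; exact: msq_ge0.
apply: ae_ge0_le_integral => //.
- by move=> w _; rewrite lee_fin sqr_ge0.
- by apply: measurable_EFin_sqr; exact: measurable_funM.
- by move=> w _; rewrite mule_ge0 ?msq_ge0.
- exact: measurable_funeM.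
apply: filterS JX => w /= -> _.
have mXw : measurable_fun setT (fun r : measurableTypeR R =>
  on_itv s t X (r, w)).
  by apply: measurableT_comp mX _; exact: measurable_pair2.
rewrite (_ : msq leb _ = ((y w ^+ 2)%:E * msq leb (fun r : measurableTypeR R =>
  on_itv s t X (r, w)))%E); last first.
  rewrite -msqZ//; apply: eq_integral => r _.
  by rewrite /on_itv /= mulrA.
rewrite muleCA exprMn EFinM; apply: lee_wpmul2l; first
  by rewrite lee_fin sqr_ge0.
exact: Rintegral_sqr_le.
Qed.

Lemma msq_on_itv_le (X : R -> T -> R) (s t : R) (C : \bar R) : s <= t ->
  (0 <= C)%E ->
  measurable_fun setT (on_itv s t X) ->
  (forall r, s <= r -> r <= t -> (msq P (X r) <= C)%E) ->
  (msq PM (on_itv s t X) <= (t - s)%:E * C)%E.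
Proof.
move=> st C0 mX XC; rewrite msq_prodE12//.
apply: (@le_trans _ _ (\int[leb]_r (C * (\1_(`[s, t]%classic) r)%:E))%E).
  apply: ge0_le_integral => //.
  - by move=> r _; exact: msq_ge0.
  - apply: (measurable_fun_fubini_tonelli_F (m2 := P) (fun p =>
    ((on_itv s t X p) ^+ 2)%:E)).
    - exact: measurable_EFin_sqr.
    - by move=> p; rewrite lee_fin sqr_ge0.
  - by apply: measurable_funeM; apply/measurable_EFinP; apply: measurable_indic;
    exact: measurable_itv.
  move=> r _; rewrite /on_itv /= indicE.
  have [|nr] := boolP (r \in _).
    rewrite inE/= in_itv/= => /andP[sr rt]; rewrite mule1.
    by under eq_fun do rewrite mulr1; exact: XC.
  by under eq_fun do rewrite mulr0; rewrite msq_cst expr0n/= mule0.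
rewrite ge0_integralZl//; last first.
  by apply/measurable_EFinP; apply: measurable_indic; exact: measurable_itv.
rewrite muleC integral_indic//= setIT lebesgue_measure_itv/= lte_fin.
case: ltP => // h.
by rewrite mul0e mule_ge0// lee_fin subr_ge0.
Qed.

End ItoBounds.

(** * Multiple Ito integrals *)

Section MultipleIntegrals.
Context (d : measure_display) (T : measurableType d) (R : realType).
Context (P : probability T R) (W : R -> {RV P >-> R}).
Context (I : multi_index -> R -> R -> T -> R).
Hypothesis HW : wiener_process W.
Hypothesis HI : multiple_ito_integrals W I.
Implicit Types (a b : multi_index) (r s t : R).

Lemma measurable_mii_on_itv a s t : 0 <= s ->
  measurable_fun setT (on_itv s t (I a s)).
Proof.
move=> s0.
have mD : measurable (`[s, t]%classic `*` [set: T] : set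
  (measurableTypeR R * T)).
  by apply: measurableX => //; exact: measurable_itv.
have mI : measurable_fun (`[s, t]%classic `*` [set: T])
    (fun p : measurableTypeR R * T => I a s p.1 p.2).
  apply: measurable_funS (mii_measurable HI a s0).
  - by apply: measurableX => //; exact: measurable_itv.
  - by move=> [x w] /= [+ _]; rewrite !in_itv/= => /andP[-> _].
have := (measurable_restrictT _ mD).1 mI.
congr measurable_fun; apply/funext => -[x w].
rewrite patchE /on_itv indicE /=.
have -> : ((x, w) \in `[s, t]%classic `*` [set: T]) = (x \in `[s, t]%classic).
  by apply/idP/idP; rewrite !inE => //= -[].
by case: (_ \in _); rewrite ?mulr1 ?mulr0.
Qed.

Lemma measurable_mii a s t : 0 <= s -> s <= t -> measurable_fun setT (I a s t).
Proof.
move=> s0 st; have : measurable_fun setT (fun w => on_itv s t (I a s) (t, w)).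
  by apply: measurableT_comp (measurable_mii_on_itv a t s0) _;
    exact: measurable_pair1.
congr measurable_fun; apply/funext => w; rewrite /on_itv /= indicE mem_set
  ?mulr1//.
by rewrite /= in_itv/= st lexx.
Qed.

(** The order in mean square: an integration in dW contributes half of what an
    integration in dt does. *)
Definition degree (a : multi_index) : nat := (size a + mi_zeros a)%N.

(** Each integration in dt costs a factor 4, from the inequality used for it;
    integrations in dW cost nothing, which keeps the bound sharp for the
    increment. *)
Definition mii_bound a (v : R) : R := 4 ^+ mi_zeros a * v ^+ degree a.

Lemma mii_bound_ge0 a v : 0 <= v -> 0 <= mii_bound a v.
Proof. by move=> v0; rewrite mulr_ge0 ?exprn_ge0. Qed.

Lemma mii_bound_le a u v : 0 <= u -> u <= v -> mii_bound a u <= mii_bound a v.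
Proof.
move=> u0 uv; rewrite ler_wpM2l ?exprn_ge0//.
by rewrite lerXn2r ?nnegrE// (le_trans u0).
Qed.

Lemma mii_bound_dW a v : mii_bound (rcons a true) v = v * mii_bound a v.
Proof.
by rewrite /mii_bound /degree /mi_zeros -cats1 count_cat size_cat/= !addn0 addn1
  addSn exprS mulrCA.
Qed.

Lemma mii_bound_dt a v : mii_bound (rcons a false) v =
  4 * v * (v * mii_bound a v).
Proof.
rewrite /mii_bound /degree /mi_zeros -cats1 count_cat size_cat/= !addn1 addSn
  addnS !exprS.
by ring.
Qed.

(** Induction on the length: the outermost integration is removed by the
    isometry inequality or by the pathwise bound, and g goes along inside the
    integrand. *)
Lemma msq_mii_past a s t (g : T -> R) : 0 <= s -> s <= t ->
  past_bounded W s g ->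
  (msq P (fun w => g w * I a s t w)%R <= (mii_bound a (t - s))%:E * msq P g)%E.
Proof.
move=> s0 + gs; have mg := past_measurable_fun gs.1.
elim/last_ind: a t => [t st|a b IH t st].
  rewrite /mii_bound /= !expr0 mulr1 mul1e (_ : msq P _ = msq P g)//.
  apply: msq_ae => //; first by apply: measurable_funM => //;
    exact: measurable_mii.
  by apply: filterS (mii_nil HI s0 st) => w ->; rewrite mulr1.
have v0 : 0 <= t - s by rewrite subr_ge0.
have mX := measurable_mii_on_itv a t s0.
have mJ := measurable_mii (rcons a b) s0 st.
have mgX : measurable_fun setT (on_itv s t (fun r w => g w * I a s r w)).
  rewrite (_ : on_itv _ _ _ = fun p => g p.2 * on_itv s t (I a s) p).
    by apply: measurable_funM => //;
      exact: (measurableT_comp mg measurable_snd).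
  by apply/funext => p; rewrite /on_itv mulrA.
have key : (msq (lebesgue_measure \x P) (on_itv s t (fun r w =>
  g w * I a s r w)%R) <=
    (t - s)%:E * ((mii_bound a (t - s))%:E * msq P g))%E.
  apply: msq_on_itv_le => //.
    by rewrite mule_ge0 ?msq_ge0// lee_fin mii_bound_ge0.
  move=> r sr rt; apply: le_trans (IH _ sr) _.
  apply: lee_wpmul2r; first exact: msq_ge0.
  by rewrite lee_fin mii_bound_le ?subr_ge0// lerD2r.
case: b mJ => mJ.
  have XJ := ito_integral_approx s0 mX (mii_dW HI a s0 st).
  have gXJ := ito_mul HW s0 mX mJ gs XJ.
  have mgJ : measurable_fun setT (fun w => g w * I (rcons a true) s t w).
    exact: measurable_funM.
  apply: le_trans (ito_msq HW s0 mgX mgJ gXJ) _.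
  by rewrite mii_bound_dW EFinM -muleA.
apply: le_trans (msq_dt st mX mJ mg (mii_dt HI a s0 st)) _.
rewrite mii_bound_dt [in leRHS]EFinM -[in leRHS]muleA; apply: lee_wpmul2l.
  by rewrite lee_fin mulr_ge0.
by rewrite EFinM -muleA.
Qed.

Lemma past_bounded_cst s (c : R) : past_bounded W s (fun=> c).
Proof. by split; [exact: past_measurable_cst|exists `|c|]. Qed.

Lemma msq_mii a s t : 0 <= s -> s <= t ->
  (msq P (I a s t) <= (mii_bound a (t - s))%:E)%E.
Proof.
move=> s0 st; have := msq_mii_past a s0 st (past_bounded_cst s 1).
by rewrite msq_cst expr1n mule1; under eq_fun do rewrite mul1r.
Qed.

Lemma msq_mii_lty a s t : 0 <= s -> s <= t -> (msq P (I a s t) < +oo)%E.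
Proof. by move=> s0 st; rewrite (le_lt_trans (msq_mii a s0 st))// ltry. Qed.

Lemma past_closure_dW a s t : 0 <= s -> s <= t ->
  past_closure W t (I (rcons a true) s t).
Proof.
move=> s0 st; apply: (ito_closure HW s0 (measurable_mii _ s0 st)).
by apply: ito_integral_approx (mii_dW HI a s0 st) => //;
  exact: measurable_mii_on_itv.
Qed.

(** The weight y is meant to be an integral over an interval after t. An
    integral in dW is an L^2 limit of functions of the past, so the bound for
    those extends to it; an integral in dt is reduced to its integrand, by
    induction. *)
Lemma msqM_mii (K r t : R) (y : T -> R) a : 0 <= r -> 0 <= K ->
  measurable_fun setT y ->
  (forall g, past_bounded W t g ->
    (msq P (fun w => y w * g w)%R <= K%:E * msq P g)%E) ->
  forall s, r <= s -> s <= t ->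
  (msq P (fun w => y w * I a r s w)%R <= (4 * K * mii_bound a (s - r))%:E)%E.
Proof.
move=> r0 K0 my yK; elim/last_ind: a => [|a b IH] s rs st.
  have mI := measurable_mii [::] r0 rs.
  rewrite (_ : msq P _ = msq P (fun w => y w * 1)); last first.
    apply: msq_ae; [exact: measurable_funM|exact: measurable_funM|].
    by apply: filterS (mii_nil HI r0 rs) => w ->.
  apply: le_trans (yK _ (past_bounded_cst t 1)) _.
  rewrite msq_cst -EFinM lee_fin /mii_bound /= !expr0 expr1n !mulr1.
  by rewrite ler_peMl// ler1n.
have v0 : 0 <= s - r by rewrite subr_ge0.
have mJ := measurable_mii (rcons a b) r0 rs.
case: b mJ => mJ.
  apply: le_trans (past_closure_msqM K0 mJ my (msq_mii_lty _ r0 rs)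
    _ (past_closure_dW a r0 rs)) _.
    by move=> g [pg gM]; apply: yK; split => //; exact: past_measurable_mono pg.
  rewrite [in leRHS]EFinM; apply: lee_wpmul2l; first
    by rewrite lee_fin mulr_ge0.
  exact: msq_mii.
have mX := measurable_mii_on_itv a s r0.
apply: le_trans (msq_dt rs mX mJ my (mii_dt HI a r0 rs)) _.
rewrite mii_bound_dt mulrCA [in leRHS]EFinM; apply: lee_wpmul2l;
  first by rewrite lee_fin mulr_ge0.
rewrite mulrCA [in leRHS]EFinM; apply: msq_on_itv_le => //.
- by rewrite lee_fin mulr_ge0 ?mii_bound_ge0// mulr_ge0.
- rewrite (_ : on_itv _ _ _ = fun p => y p.2 * on_itv r s (I a r) p).
    by apply: measurable_funM => //;
      exact: (measurableT_comp my measurable_snd).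
  by apply/funext => p; rewrite /on_itv mulrA.
move=> x rx xs; apply: le_trans (IH _ rx (le_trans xs st)) _.
by rewrite lee_fin ler_wpM2l ?mulr_ge0// mii_bound_le ?subr_ge0// lerD2r.
Qed.

Lemma msq_mii_mii a b r s t : 0 <= r -> r <= s -> s <= t ->
  (msq P (fun w => I b s t w * I a r s w)%R <=
    (4 * mii_bound b (t - s) * mii_bound a (s - r))%:E)%E.
Proof.
move=> r0 rs st; have s0 := le_trans r0 rs.
apply: (@msqM_mii _ _ s) => //.
- by rewrite mii_bound_ge0// subr_ge0.
- exact: measurable_mii.
by move=> g gs; under eq_fun do rewrite mulrC; exact: msq_mii_past.
Qed.

Lemma mean0_dW a s t : 0 <= s -> s <= t -> mean0 P (I (rcons a true) s t).
Proof.
move=> s0 st; apply: (ito_mean0 HW s0 (measurable_mii _ s0 st)).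
by apply: ito_integral_approx (mii_dW HI a s0 st) => //;
  exact: measurable_mii_on_itv.
Qed.

(** For bounded g instead of the first factor, the product is again an Ito
    integral, hence centred; the first factor is an L^2 limit of such g. *)
Lemma mean0_dW_dW a b r s t : 0 <= r -> r <= s -> s <= t ->
  mean0 P (fun w => I (rcons a true) r s w * I (rcons b true) s t w).
Proof.
move=> r0 rs st; have s0 := le_trans r0 rs.
have mJ := measurable_mii (rcons b true) s0 st.
apply: (past_closure_mean0M (measurable_mii _ r0 rs) mJ (msq_mii_lty _ s0 st)
  _ (past_closure_dW a r0 rs)).
move=> g gs; have mX := measurable_mii_on_itv b t s0.
have XJ := ito_integral_approx s0 mX (mii_dW HI b s0 st).
apply: (ito_mean0 HW s0 _ (ito_mul HW s0 mX mJ gs XJ)).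
by apply: measurable_funM => //; exact: past_measurable_fun gs.1.
Qed.

End MultipleIntegrals.

(** * Orders of magnitude in mean square *)

Section ComplexMeanSquare.
Local Open Scope complex_scope.
Context (R : realType).
Implicit Types (x y z c : R[i]).

Definition sqn z : R := complex.Re z ^+ 2 + complex.Im z ^+ 2.

Lemma normc_sqr z : Normc.normc z ^+ 2 = sqn z.
Proof. by case: z => a b; rewrite /sqn /= sqr_sqrtr// addr_ge0 ?sqr_ge0. Qed.

Lemma sqn_ge0 z : 0 <= sqn z.
Proof. by rewrite addr_ge0 ?sqr_ge0. Qed.

Lemma sqnM x y : sqn (x * y) = sqn x * sqn y.
Proof. by case: x => a b; case: y => c e; rewrite /sqn /=; ring. Qed.

Lemma sqnR (r : R) : sqn r%:C = r ^+ 2.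
Proof. by rewrite /sqn /= expr0n addr0. Qed.

Lemma sqn1 : sqn 1 = 1.
Proof. by rewrite /sqn /= expr1n expr0n addr0. Qed.

Lemma sqnN z : sqn (- z) = sqn z.
Proof. by case: z => a b; rewrite /sqn /= !sqrrN. Qed.

Lemma sqnD_le (e : R) x y : 0 < e ->
  sqn (x + y) <= (1 + e) * sqn x + (1 + e^-1) * sqn y.
Proof.
move=> e0; case: x => a b; case: y => c f; rewrite /sqn /=.
have := sqrrD_le a c e0; have := sqrrD_le b f e0.
by rewrite !mulrDr; lra.
Qed.

Lemma sqnD2 x y : sqn (x + y) <= 2 * sqn x + 2 * sqn y.
Proof. by have := sqnD_le x y ltr01; rewrite invr1. Qed.

(** The implicit stages divide by numbers of real part at least 1. *)
Lemma sqnV_le1 z : 1 <= complex.Re z -> sqn z^-1 <= 1.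
Proof.
move=> z1; have sz : 1 <= sqn z.
  have : 0 <= complex.Im z ^+ 2 by exact: sqr_ge0.
  by rewrite /sqn; nra.
have z0 : z != 0.
  by apply/eqP => z0; move: z1; rewrite z0 /= ler10.
have : sqn z * sqn z^-1 = 1 by rewrite -sqnM divff// sqn1.
by have := sqn_ge0 z^-1; nra.
Qed.

Lemma Re_addr x y : complex.Re (x + y) = complex.Re x + complex.Re y.
Proof. by case: x; case: y. Qed.
Lemma Im_addr x y : complex.Im (x + y) = complex.Im x + complex.Im y.
Proof. by case: x; case: y. Qed.
Lemma Re_mulr x y : complex.Re (x * y) =
  complex.Re x * complex.Re y - complex.Im x * complex.Im y.
Proof. by case: x; case: y. Qed.
Lemma Im_mulr x y : complex.Im (x * y) =
  complex.Re x * complex.Im y + complex.Im x * complex.Re y.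
Proof. by case: x; case: y. Qed.

(** The square of the modulus is O(h^k) on ]0, 1]; squares are used so that
    the exponents match those of mean squares. *)
Definition detO (k : nat) (c : R -> R[i]) := exists2 C : R, 0 <= C &
  forall h, 0 < h -> h <= 1 -> sqn (c h) <= C * h ^+ k.

Lemma detO_cst c : detO 0 (fun=> c).
Proof.
by exists (sqn c); [exact: sqn_ge0|move=> h _ _; rewrite expr0 mulr1].
Qed.

Lemma detO_h : detO 2 (fun h => h%:C).
Proof. by exists 1 => // h _ _; rewrite sqnR mul1r. Qed.

Lemma detOM j k (c c' : R -> R[i]) : detO j c -> detO k c' ->
  detO (j + k) (fun h => c h * c' h).
Proof.
move=> [C C0 H] [C' C'0 H']; exists (C * C'); first exact: mulr_ge0.
move=> h h0 h1; rewrite sqnM exprD mulrACA ler_pM ?sqn_ge0//;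
  [exact: H|exact: H'].
Qed.

Lemma detOD k (c c' : R -> R[i]) : detO k c -> detO k c' ->
  detO k (fun h => c h + c' h).
Proof.
move=> [C C0 H] [C' C'0 H']; exists (2 * C + 2 * C').
  by rewrite addr_ge0// mulr_ge0.
move=> h h0 h1; apply: le_trans (sqnD2 _ _) _.
by have := H h h0 h1; have := H' h h0 h1; rewrite mulrDl; lra.
Qed.

Lemma detO_weak j k (c : R -> R[i]) : (j <= k)%N -> detO k c -> detO j c.
Proof.
move=> jk [C C0 H]; exists C => // h h0 h1; apply: le_trans (H h h0 h1) _.
by rewrite ler_wpM2l// ler_wiXn2l// ltW.
Qed.

Lemma detON k (c : R -> R[i]) : detO k c -> detO k (fun h => - c h).
Proof. by move=> [C C0 H]; exists C => // h h0 h1; rewrite sqnN H. Qed.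

Context (d : measure_display) (T : measurableType d) (P : probability T R).

Definition cmeas (f : T -> R[i]) :=
  measurable_fun setT (fun w => complex.Re (f w)) /\
  measurable_fun setT (fun w => complex.Im (f w)).

Definition cmsq (f : T -> R[i]) : \bar R := (\int[P]_w (sqn (f w))%:E)%E.

Lemma cmeasD f g : cmeas f -> cmeas g -> cmeas (fun w => f w + g w).
Proof.
move=> [fr fi] [gr gi]; split.
  by under eq_fun do rewrite Re_addr; exact: measurable_funD.
by under eq_fun do rewrite Im_addr; exact: measurable_funD.
Qed.

Lemma cmeasM f g : cmeas f -> cmeas g -> cmeas (fun w => f w * g w).
Proof.
move=> [fr fi] [gr gi]; split.
  by under eq_fun do rewrite Re_mulr; apply: measurable_funB;
    exact: measurable_funM.
by under eq_fun do rewrite Im_mulr; apply: measurable_funD;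
  exact: measurable_funM.
Qed.

Lemma cmeas_cst c : cmeas (fun=> c).
Proof. by split; exact: measurable_cst. Qed.

Lemma cmeasR (x : T -> R) : measurable_fun setT x -> cmeas (fun w => (x w)%:C).
Proof. by move=> mx; split => //=; exact: measurable_cst. Qed.

Lemma cmsqE f : cmeas f ->
  cmsq f = (msq P (fun w => complex.Re (f w)) + msq P (fun w =>
    complex.Im (f w)))%E.
Proof.
move=> [fr fi]; rewrite /msq -ge0_integralD//.
- by move=> w _; rewrite lee_fin sqr_ge0.
- exact: measurable_EFin_sqr.
- by move=> w _; rewrite lee_fin sqr_ge0.
- exact: measurable_EFin_sqr.
Qed.

Lemma cmsq_ge0 f : (0 <= cmsq f)%E.
Proof. by apply: integral_ge0 => w _; rewrite lee_fin sqn_ge0. Qed.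

Lemma measurable_sqn f : cmeas f -> measurable_fun setT (fun w =>
  (sqn (f w))%:E).
Proof.
move=> [fr fi]; apply/measurable_EFinP.
by apply: measurable_funD; exact: measurable_funX.
Qed.

Lemma cmsqD f g (e : R) : 0 < e -> cmeas f -> cmeas g ->
  (cmsq (fun w => f w + g w)%R <= (1 + e)%:E * cmsq f + (1 + e^-1)%:E * cmsq
    g)%E.
Proof.
move=> e0 mf mg; have e1 : 0 <= e^-1 by rewrite invr_ge0 ltW.
have e2 : 0 <= 1 + e by rewrite addr_ge0// ltW.
have e3 : 0 <= 1 + e^-1 by rewrite addr_ge0.
have mf' := measurable_sqn mf; have mg' := measurable_sqn mg.
rewrite /cmsq -!ge0_integralZl//; try by move=> w _; rewrite lee_fin sqn_ge0.
rewrite -ge0_integralD//; first last.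
- exact: measurable_funeM.
- by move=> w _; rewrite -EFinM lee_fin mulr_ge0 ?sqn_ge0.
- exact: measurable_funeM.
- by move=> w _; rewrite -EFinM lee_fin mulr_ge0 ?sqn_ge0.
apply: ge0_le_integral => //.
- by move=> w _; rewrite lee_fin sqn_ge0.
- by apply: measurable_sqn; exact: cmeasD.
- by apply: emeasurable_funD; exact: measurable_funeM.
- by move=> w _; rewrite -!EFinM -EFinD lee_fin sqnD_le.
Qed.

Lemma cmsqZ c f : cmeas f -> cmsq (fun w => c * f w) = ((sqn c)%:E * cmsq f)%E.
Proof.
move=> mf; rewrite /cmsq -ge0_integralZl//.
- by apply: eq_integral => w _; rewrite sqnM EFinM.
- exact: measurable_sqn.
- by move=> w _; rewrite lee_fin sqn_ge0.
- by rewrite lee_fin sqn_ge0.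
Qed.

Lemma cmsqR (x : T -> R) : cmsq (fun w => (x w)%:C) = msq P x.
Proof. by apply: eq_integral => w _; rewrite sqnR. Qed.

Implicit Types F G : R -> nat -> T -> R[i].

(** The mean square is O(h^k) on ]0, 1], uniformly in the step number n. *)
Definition ranO (k : nat) F := exists2 C : R, 0 <= C &
  forall h n, 0 < h -> h <= 1 ->
    cmeas (F h n) /\ (cmsq (F h n) <= (C * h ^+ k)%:E)%E.

Lemma ranO_eq k F G : (forall h n w, F h n w = G h n w) -> ranO k F -> ranO k G.
Proof.
by move=> FG; rewrite (_ : F = G)//; apply/funext => h; apply/funext => n;
  apply/funext => w.
Qed.

Lemma ranO_weak j k F : (j <= k)%N -> ranO k F -> ranO j F.
Proof.
move=> jk [C C0 H]; exists C => // h n h0 h1; have [m l] := H h n h0 h1;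
  split => //.
apply: le_trans l _; rewrite lee_fin ler_wpM2l//.
by rewrite ler_wiXn2l// ltW.
Qed.

Lemma ranOD k F G : ranO k F -> ranO k G ->
  ranO k (fun h n w => F h n w + G h n w).
Proof.
move=> [C C0 HF] [C' C'0 HG]; exists (2 * C + 2 * C');
  first by rewrite addr_ge0// mulr_ge0.
move=> h n h0 h1; have [mF lF] := HF h n h0 h1; have [mG lG] := HG h n h0 h1.
split; first exact: cmeasD.
have := cmsqD ltr01 mF mG; rewrite invr1 => /le_trans; apply.
by rewrite mulrDl [in leRHS]EFinD; apply: leeD; rewrite -mulrA [in leRHS]EFinM;
  apply: lee_wpmul2l.
Qed.

Lemma ranOZ j k (c : R -> R[i]) F : detO j c -> ranO k F ->
  ranO (j + k) (fun h n w => c h * F h n w).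
Proof.
move=> [C C0 Hc] [C' C'0 HF]; exists (C * C'); first exact: mulr_ge0.
move=> h n h0 h1; have [mF lF] := HF h n h0 h1.
split; first by apply: cmeasM => //; exact: cmeas_cst.
rewrite cmsqZ// exprD mulrACA EFinM; apply: lee_pmul => //.
- by rewrite lee_fin sqn_ge0.
- exact: cmsq_ge0.
- by rewrite lee_fin Hc.
Qed.

Lemma ranO0 k : ranO k (fun _ _ _ => 0).
Proof.
exists 0 => // h n _ _; split; first exact: cmeas_cst.
by rewrite (cmsqR (fun=> 0)) msq_cst expr0n mul0r.
Qed.

Lemma ranO_sum k (A : eqType) (s : seq A) (F : A -> R -> nat -> T -> R[i]) :
  {in s, forall a, ranO k (F a)} ->
  ranO k (fun h n w => \sum_(a <- s) F a h n w).
Proof.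
elim: s => [_|a s IH H].
  by apply: ranO_eq (ranO0 k) => h n w; rewrite big_nil.
apply: (@ranO_eq _ (fun h n w => F a h n w + \sum_(a <- s) F a h n w)).
  by move=> h n w; rewrite big_cons.
apply: ranOD; first by apply: H; rewrite mem_head.
by apply: IH => b bs; apply: H; rewrite inE bs orbT.
Qed.

End ComplexMeanSquare.

(** * The factor of one step *)

Section Scheme.
Local Open Scope complex_scope.
Context (R : realType).
Variables (la si : R[i]).

(** The part of the truncated expansion of degree at least 3. *)
Definition ito_rest (i : multi_index -> R) : R[i] :=
  \sum_(a <- drop 2 mi_set)
    la ^+ mi_zeros a * si ^+ (size a - mi_zeros a) * (i a)%:C.

Lemma ito_sumE (i : multi_index -> R) : ito_sum la si i =
  si * (i [:: true])%:C + si ^+ 2 * (i [:: true; true])%:C + ito_rest i.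
Proof.
by rewrite /ito_sum /ito_rest !big_cons /= !expr0 !mul1r expr1 !addrA.
Qed.

Let kappa : R[i] := 1 / 2 * (gam R)%:C.
Let mu2 : R[i] := (gam2 R)%:C.
Let g3 : R[i] := (gam3 R)%:C.
Let bb (h : R) : R[i] := (1 - la * (h%:C * kappa))^-1.
Let bt (h : R) : R[i] := (1 - la * (h%:C * mu2))^-1.
Let aa (h : R) : R[i] := (1 + la * (h%:C * kappa)) * bb h.

(** The coefficients of the factor of one step; coefD is the factor of the
    deterministic scheme. *)
Definition coefD h := bt h * (g3 * aa h + (1 - g3)).
Definition coef1 h := bt h * (g3 * bb h + (1 - g3)) * si.
Definition coef2 h := bt h * aa h * si.
Definition coef11 h := bt h * (g3 * bb h + (1 - g3)) * si ^+ 2.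
Definition coef22 h := bt h * aa h * si ^+ 2.
Definition coef12 h := bt h * bb h * si ^+ 2.

(** The terms of degree at least 3. Here u' and v' are the contributions of
    the two intervals to the stages, without the increments, and u is the
    whole contribution of the first interval. *)
Definition remainder h (i1 i2 : multi_index -> R) : R[i] :=
  let p := ito_theta la si i1 in let t := ito_theta la si i2 in
  let u := ito_sum la si i1 - h%:C * kappa * p in
  let u' := si ^+ 2 * (i1 [:: true; true])%:C + (ito_rest i1 - h%:C * kappa * p)
    in
  let v' := si ^+ 2 * (i2 [:: true; true])%:C + (ito_rest i2 - h%:C * mu2 * t)
    in
  bt h * (g3 * bb h) * (ito_rest i1 - h%:C * kappa * p)
  + bt h * (1 - g3) * (ito_rest i1 - h%:C * (2 * kappa) * p)
  + bt h * aa h * (ito_rest i2 - h%:C * mu2 * t)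
  + (bt h * bb h * si) * ((i2 [:: true])%:C * u')
  + (bt h * bb h) * (u * v').

Hypothesis la0 : complex.Re la < 0.

Lemma gam2_gt0 : 0 < gam2 R.
Proof.
have /andP[g0 g1] := gam_bounds R.
by rewrite divr_gt0 ?subr_gt0// (lt_trans g1)// ltr1n.
Qed.

Lemma kappaE : kappa = (gam R / 2)%:C.
Proof. by rewrite /kappa rmorphM /= fmorphV rmorph_nat mul1r mulrC. Qed.

(** The drift being dissipative, the implicit stages only contract. *)
Lemma Re_implicit (h x : R) : 0 < h -> 0 < x ->
  1 <= complex.Re (1 - la * (h%:C * x%:C)).
Proof.
move=> h0 x0; rewrite -rmorphM; case: la la0 => p q /= p0.
by rewrite mulr0 subr0 lerDl oppr_ge0 ltW// pmulr_llt0// mulr_gt0.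
Qed.

Lemma kappa_pos : 0 < gam R / 2.
Proof. by have /andP[g0 _] := gam_bounds R; rewrite divr_gt0. Qed.

Lemma Re_ge1_neq0 (z : R[i]) : 1 <= complex.Re z -> z != 0.
Proof. by move=> z1; apply/eqP => z0; move: z1; rewrite z0 /= ler10. Qed.

(** One step of the geometric expansion of the inverse. *)
Lemma bbE h : 0 < h -> bb h = 1 + la * (h%:C * kappa) * bb h.
Proof.
move=> h0; have := Re_ge1_neq0 (Re_implicit h0 kappa_pos); rewrite -kappaE =>
  z0.
have b1 : (1 - la * (h%:C * kappa)) * bb h = 1 by rewrite divff.
transitivity ((1 - la * (h%:C * kappa)) * bb h + la * (h%:C * kappa) * bb h);
  last by rewrite b1.
by ring.
Qed.

Lemma btE h : 0 < h -> bt h = 1 + la * (h%:C * mu2) * bt h.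
Proof.
move=> h0; have z0 := Re_ge1_neq0 (Re_implicit h0 gam2_gt0).
rewrite -/mu2 in z0; have b1 : (1 - la * (h%:C * mu2)) * bt h =
  1 by rewrite divff.
transitivity ((1 - la * (h%:C * mu2)) * bt h + la * (h%:C * mu2) * bt h);
  last by rewrite b1.
by ring.
Qed.

(** Uniqueness of the factor: the stages are solved for Y_n = 1, and the
    result is sorted by degree. *)
Lemma trbdf2_factorE h i1 i2 rho : 0 < h -> trbdf2_factor h la si i1 i2 rho ->
  rho = (coefD h + (coef1 h * (i1 [:: true])%:C + coef2 h * (i2 [:: true])%:C
    + (coef11 h * (i1 [:: true; true])%:C + coef22 h * (i2 [:: true; true])%:C
    + coef12 h * ((i1 [:: true])%:C * (i2 [:: true])%:C)))) + remainder h i1 i2.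
Proof.
move=> h0 H; have [q [rho' step]] := trbdf2_stepP si i1 i2 h0 la0.
have st := proj2 (step 1 (q * 1) (rho' * 1)) (conj erefl erefl).
(* The defining property of the factor, applied to the solution that starts
   from 1, makes the two stage equations available for rho itself. *)
have := H _ _ _ st; rewrite !mulr1 => rhoE; move: st;
  rewrite !mulr1 rhoE /trbdf2_step.
move=> {H step rhoE rho'} [E1 E2].
have z1 := Re_ge1_neq0 (Re_implicit h0 kappa_pos); rewrite -kappaE in z1.
have z2 := Re_ge1_neq0 (Re_implicit h0 gam2_gt0); rewrite -/mu2 in z2.
have b1 : (1 - la * (h%:C * kappa)) * bb h = 1 by rewrite divff.
have b2 : (1 - la * (h%:C * mu2)) * bt h = 1 by rewrite divff.
(* Both stages are rewritten in terms of the step constants kappa and mu2, so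
   that they can be divided by their implicit coefficients. *)
have half : 1 / 2 * h%:C * (gam R)%:C = h%:C * kappa by rewrite /kappa; ring.
have qE : q = aa h + bb h * (ito_sum la si i1 - h%:C * kappa * ito_theta la si
  i1).
  apply: (mulfI z1); rewrite /aa.
  rewrite [RHS](_ : _ = (1 - la * (h%:C * kappa)) * bb h *
    (1 + la * (h%:C * kappa)
    + (ito_sum la si i1 - h%:C * kappa * ito_theta la si i1))); last by ring.
  rewrite b1 mul1r.
  have : q = 1 + la * (1 + q) * (h%:C * kappa)
      + (ito_sum la si i1 - h%:C * kappa * ito_theta la si i1).
    by rewrite {1}E1 -half; ring.
  by move=> E; rewrite mulrBl {1}E; ring.
have E2' : rho = bt h * (g3 * q + (1 - g3)
    + (1 - g3) * (ito_sum la si i1 - h%:C * (2 * kappa) * ito_theta la si i1)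
    + (ito_sum la si i2 - h%:C * mu2 * ito_theta la si i2) * q).
  apply: (mulfI z2); rewrite [RHS]mulrA b2 mul1r mulrBl {1}E2 -/g3 -/mu2.
  have -> : h%:C * (gam R)%:C = h%:C * (2 * kappa).
    by rewrite /kappa [2 * _]mulrA mul1r divff ?mul1r// pnatr_eq0.
  by ring.
rewrite E2' qE /remainder /coefD /coef1 /coef2 /coef11 /coef22 /coef12
  !ito_sumE.
move: (ito_rest i1) (ito_rest i2) (ito_theta la si i1) (ito_theta la si i2).
move: ((i1 [:: true])%:C) ((i2 [:: true])%:C) ((i1 [:: true; true])%:C)
  ((i2 [:: true; true])%:C).
move: (bb h) (bt h) (aa h) (h%:C) => *; ring.
Qed.

Lemma detO_bb : detO 0 bb.
Proof.
exists 1 => // h h0 h1; rewrite expr0 mulr1 sqnV_le1//.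
by rewrite kappaE Re_implicit// kappa_pos.
Qed.

Lemma detO_bt : detO 0 bt.
Proof.
exists 1 => // h h0 h1; rewrite expr0 mulr1 sqnV_le1//.
by rewrite Re_implicit// gam2_gt0.
Qed.

Lemma detO_hM (c : R[i]) : detO 2 (fun h => h%:C * c).
Proof. exact: (detOM (detO_h R) (detO_cst c)). Qed.

Lemma detO_aa : detO 0 aa.
Proof.
apply: (detOM (j := 0) (k := 0)) detO_bb; apply: detOD; first exact: detO_cst.
apply: (detOM (j := 0) (k := 0)); first exact: detO_cst.
exact: (detO_weak (isT : (0 <= 2)%N) (detO_hM _)).
Qed.

(** The condition of order one on the parameters of the scheme. *)
Lemma trbdf2_order1 : 2 * g3 * kappa + mu2 = 1.
Proof.
have /andP[g0 g1] := gam_bounds R.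
rewrite kappaE /g3 /mu2 (_ : 2 = 2%:C); last by rewrite rmorph_nat.
rewrite -!rmorphM -rmorphD (_ : _ + _ = 1) ?rmorph1//.
rewrite /gam3 /gam2; field.
by apply/andP; split; rewrite gt_eqF// subr_gt0 (lt_trans g1)// ltr1n.
Qed.

(** The deterministic part is consistent of order one. *)
Lemma coefD_expand : exists2 e, detO 4 e &
  forall h, 0 < h -> coefD h = 1 + la * h%:C + e h.
Proof.
pose e h := h%:C * h%:C * (la ^+ 2 * (mu2 ^+ 2 * bt h + 2 * g3 * kappa * mu2 *
  bt h
   + 2 * g3 * kappa ^+ 2 * (bb h * bt h))).
exists e.
  apply: (detOM (j := 4) (k := 0)); first exact: (detOM (detO_h R) (detO_h R)).
  apply: (detOM (j := 0) (k := 0)); first exact: detO_cst.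
  have bz c f : detO 0 f -> detO 0 (fun h => c * f h).
    by move=> bf; exact: (detOM (detO_cst c) bf).
  apply: detOD; first apply: detOD.
  - exact/bz/detO_bt.
  - exact/bz/detO_bt.
  - by apply: bz; exact: (detOM detO_bb detO_bt).
move=> h h0; rewrite /coefD /aa /e.
have := bbE h0; have := btE h0; have := trbdf2_order1.
move: (bb h) (bt h) (h%:C) => b t x.
move=> o tE bE.
have -> : la * x = (2 * g3 * kappa + mu2) * (la * x) by rewrite o mul1r.
have d0 : b - (1 + la * (x * kappa) * b) = 0 by rewrite -bE subrr.
have -> : (1 + la * (x * kappa)) * b =
    1 + 2 * (la * (x * kappa)) + 2 * (la * (x * kappa)) ^+ 2 * b.
  apply/eqP; rewrite -subr_eq0.
  rewrite (_ : _ - _ = (1 + 2 * (la * (x * kappa))) *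
    (b - (1 + la * (x * kappa) * b))).
    by rewrite d0 mulr0.
  by ring.
have t0 : t - (1 + la * (x * mu2) * t) = 0 by rewrite -tE subrr.
apply/eqP; rewrite -subr_eq0.
rewrite (_ : _ - _ = (1 + la * (x * mu2) + 2 * g3 * (la * (x * kappa))) *
  (t - (1 + la * (x * mu2) * t))).
  by rewrite t0 mulr0.
by ring.
Qed.

Lemma coef1_expand : exists2 e, detO 2 e & forall h, 0 < h -> coef1 h =
  si + e h.
Proof.
pose e h := h%:C * (la * si * (mu2 * bt h + g3 * kappa * (bb h * bt h))).
exists e.
  apply: (detOM (j := 2) (k := 0)); first exact: detO_h.
  apply: (detOM (j := 0) (k := 0)); first exact: detO_cst.
  apply: detOD.
    exact: (detOM (detO_cst mu2) detO_bt).
  exact: (detOM (detO_cst (g3 * kappa)) (detOM detO_bb detO_bt)).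
move=> h h0; rewrite /coef1 /e; have := bbE h0; have := btE h0.
move: (bb h) (bt h) (h%:C) => b t x tE bE.
have d0 : b - (1 + la * (x * kappa) * b) = 0 by rewrite -bE subrr.
have t0 : t - (1 + la * (x * mu2) * t) = 0 by rewrite -tE subrr.
apply/eqP; rewrite -subr_eq0.
rewrite (_ : _ - _ = si * ((t - (1 + la * (x * mu2) * t)) + t * g3 *
  (b - (1 + la * (x * kappa) * b)))).
  by rewrite t0 d0 mulr0 addr0 mulr0.
by ring.
Qed.

Lemma coef2_expand : exists2 e, detO 2 e & forall h, 0 < h -> coef2 h =
  si + e h.
Proof.
pose e h := h%:C * (la * si * (mu2 * bt h + 2 * kappa * (bb h * bt h))).
exists e.
  apply: (detOM (j := 2) (k := 0)); first exact: detO_h.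
  apply: (detOM (j := 0) (k := 0)); first exact: detO_cst.
  apply: detOD.
    exact: (detOM (detO_cst mu2) detO_bt).
  exact: (detOM (detO_cst (2 * kappa)) (detOM detO_bb detO_bt)).
move=> h h0; rewrite /coef2 /aa /e; have := bbE h0; have := btE h0.
move: (bb h) (bt h) (h%:C) => b t x tE bE.
have d0 : b - (1 + la * (x * kappa) * b) = 0 by rewrite -bE subrr.
have t0 : t - (1 + la * (x * mu2) * t) = 0 by rewrite -tE subrr.
apply/eqP; rewrite -subr_eq0.
rewrite (_ : _ - _ = si * ((t - (1 + la * (x * mu2) * t)) + t *
  (b - (1 + la * (x * kappa) * b)))).
  by rewrite t0 d0 mulr0 addr0 mulr0.
by ring.
Qed.

Lemma detO_coef11 : detO 0 coef11.
Proof.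
apply: (detOM (j := 0) (k := 0)); last exact: detO_cst.
apply: (detOM (j := 0) (k := 0)) detO_bt _; apply: detOD; last exact: detO_cst.
exact: (detOM (detO_cst g3) detO_bb).
Qed.

Lemma detO_coef22 : detO 0 coef22.
Proof. exact: (detOM (detOM detO_bt detO_aa) (detO_cst (si ^+ 2))). Qed.

Lemma detO_coef12 : detO 0 coef12.
Proof. exact: (detOM (detOM detO_bt detO_bb) (detO_cst (si ^+ 2))). Qed.

(** The linear term 2 Re y of a perturbation y = O(h^2) is absorbed by h^2 +
    (Re y)^2 / h^2. *)
Lemma sqn_detO4 (e : R -> R[i]) (z : R[i]) : detO 4 e ->
  exists2 C : R, 0 <= C & forall h : R, 0 < h -> h <= 1 ->
  sqn (1 + z * h%:C + e h) <= 1 + 2 * complex.Re z * h + C * h ^+ 2.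
Proof.
move=> [C C0 H]; exists (1 + C + 2 * sqn z + 2 * C).
  by rewrite !addr_ge0 ?mulr_ge0 ?sqn_ge0.
move=> h h0 h1; have := H h h0 h1; move: (e h) => {H}y Hy.
have -> : sqn (1 + z * h%:C + y) = 1 + 2 * complex.Re z * h + 2 * complex.Re y
    + sqn (z * h%:C + y).
  by case: z => p q; case: y Hy => r u _; rewrite /sqn /=; ring.
have h4 : h ^+ 4 <= h ^+ 2 by rewrite ler_wiXn2l// ltW.
have e1 : sqn (z * h%:C + y) <= 2 * sqn z * h ^+ 2 + 2 * C * h ^+ 2.
  apply: le_trans (sqnD2 _ _) _; rewrite sqnM sqnR.
  have : C * h ^+ 4 <= C * h ^+ 2 by rewrite ler_wpM2l.
  by lra.
have e2 : 2 * complex.Re y <= (1 + C) * h ^+ 2.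
  have yr : complex.Re y ^+ 2 <= C * h ^+ 4.
    by apply: le_trans Hy; rewrite lerDl sqr_ge0.
  have hh : 0 < h ^+ 2 by rewrite exprn_gt0.
  rewrite -(ler_pM2l hh).
  have : 0 <= (h ^+ 2 - complex.Re y) ^+ 2 by exact: sqr_ge0.
  have -> : (h ^+ 2 - complex.Re y) ^+ 2 = h ^+ 4 - 2 * (h ^+ 2 * complex.Re y)
    + complex.Re y ^+ 2 by ring.
  have -> : h ^+ 2 * ((1 + C) * h ^+ 2) = h ^+ 4 + C * h ^+ 4 by ring.
  lra.
by rewrite !mulrDl mul1r; move: e1 e2; rewrite mulrDl mul1r; lra.
Qed.

Lemma sqn_detO2 (e : R -> R[i]) (z : R[i]) : detO 2 e ->
  exists2 C : R, 0 <= C & forall h : R, 0 < h -> h <= 1 ->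
  sqn (z + e h) <= sqn z + C * h.
Proof.
move=> [C C0 H]; exists (sqn z + 2 * C); first by rewrite addr_ge0 ?sqn_ge0//
  mulr_ge0.
move=> h h0 h1; apply: le_trans (sqnD_le z (e h) h0) _.
have := H h h0 h1; have hi : 0 < h^-1 by rewrite invr_gt0.
move=> Hh; have : (1 + h^-1) * sqn (e h) <= (1 + h^-1) * (C * h ^+ 2).
  by rewrite ler_wpM2l// addr_ge0// ltW.
have -> : (1 + h^-1) * (C * h ^+ 2) = C * h ^+ 2 + C * h by field;
  rewrite gt_eqF.
have : C * h ^+ 2 <= C * h by rewrite ler_wpM2l// expr2 ler_piMl// ltW.
by lra.
Qed.

End Scheme.

(** * The remainder *)

Section RemainderOrder.
Local Open Scope complex_scope.
Context (R : realType) (d : measure_display) (T : measurableType d).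
Context (P : probability T R) (la si : R[i]).
Implicit Types (i : multi_index -> R -> nat -> T -> R) (y : R -> nat -> T ->
  R[i]).

(** Here y stands for a factor, such as an integral over the other interval,
    which multiplies the mean square of every integral I_a by h^k. *)
Lemma ranO_rest i y k :
  {in mi_set, forall a, ranO P (k + degree a) (fun h n w =>
    y h n w * (i a h n w)%:C)} ->
  ranO P (k + 3) (fun h n w => y h n w * ito_rest la si (fun a => i a h n w)).
Proof.
move=> H; apply: (@ranO_eq _ _ _ _ _ (fun h n w => \sum_(a <- drop 2 mi_set)
    la ^+ mi_zeros a * si ^+ (size a - mi_zeros a) *
      (y h n w * (i a h n w)%:C))).
  by move=> h n w; rewrite /ito_rest mulr_sumr; apply: eq_bigr => a _;
    rewrite mulrCA.
apply: ranO_sum => a ad; have am : a \in mi_set by exact: mem_drop ad.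
have deg3 : (3 <= degree a)%N.
  have /allP/(_ a ad) : all (fun a => 3 <= degree a)%N (drop 2 mi_set) by [].
  by [].
apply: (@ranO_weak _ _ _ _ _ (0 + (k + degree a))%N).
  by rewrite add0n leq_add2l.
by apply: ranOZ (H _ am); exact: detO_cst.
Qed.

Lemma ranO_theta i y k :
  {in mi_set, forall a, ranO P (k + degree a) (fun h n w =>
    y h n w * (i a h n w)%:C)} ->
  ranO P (k + 1) (fun h n w => y h n w * ito_theta la si (fun a => i a h n w)).
Proof.
move=> H; apply: (@ranO_eq _ _ _ _ _ (fun h n w =>
    la * si * (y h n w * (i [:: true] h n w)%:C) +
    la * si ^+ 2 * (y h n w * (i [:: true; true] h n w)%:C))).
  by move=> h n w; rewrite /ito_theta; ring.
apply: ranOD.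
  exact: (ranOZ (detO_cst (la * si)) (H [:: true] isT)).
apply: (@ranO_weak _ _ _ _ _ (0 + (k + 2))%N); first by rewrite add0n leq_add2l.
exact: (ranOZ (detO_cst (la * si ^+ 2)) (H [:: true; true] isT)).
Qed.

Lemma ranO_defect i y k (c : R -> R[i]) : detO 2 c ->
  {in mi_set, forall a, ranO P (k + degree a) (fun h n w =>
    y h n w * (i a h n w)%:C)} ->
  ranO P (k + 3) (fun h n w => y h n w * (ito_rest la si (fun a => i a h n w)
    - c h * ito_theta la si (fun a => i a h n w))).
Proof.
move=> bc H; apply: (@ranO_eq _ _ _ _ _ (fun h n w =>
    y h n w * ito_rest la si (fun a => i a h n w) +
    - c h * (y h n w * ito_theta la si (fun a => i a h n w)))).
  by move=> h n w; ring.
apply: ranOD; first exact: ranO_rest.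
by have := ranOZ (detON bc) (ranO_theta H); rewrite addnCA.
Qed.

Lemma ranO_tail i y k (c : R -> R[i]) : detO 2 c ->
  {in mi_set, forall a, ranO P (k + degree a) (fun h n w =>
    y h n w * (i a h n w)%:C)} ->
  ranO P (k + 2) (fun h n w =>
    y h n w * (si ^+ 2 * (i [:: true; true] h n w)%:C +
    (ito_rest la si (fun a => i a h n w)
    - c h * ito_theta la si (fun a => i a h n w)))).
Proof.
move=> bc H; apply: (@ranO_eq _ _ _ _ _ (fun h n w =>
    si ^+ 2 * (y h n w * (i [:: true; true] h n w)%:C) +
    y h n w * (ito_rest la si (fun a => i a h n w)
    - c h * ito_theta la si (fun a => i a h n w)))).
  by move=> h n w; ring.
apply: ranOD; first exact: (ranOZ (detO_cst (si ^+ 2)) (H [:: true; true] isT)).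
by apply: ranO_weak (ranO_defect bc H); rewrite leq_add2l.
Qed.

Lemma ranO_stage i y k (c : R -> R[i]) : detO 2 c ->
  {in mi_set, forall a, ranO P (k + degree a) (fun h n w =>
    y h n w * (i a h n w)%:C)} ->
  ranO P (k + 1) (fun h n w => y h n w * (ito_sum la si (fun a => i a h n w)
    - c h * ito_theta la si (fun a => i a h n w))).
Proof.
move=> bc H; apply: (@ranO_eq _ _ _ _ _ (fun h n w =>
    si * (y h n w * (i [:: true] h n w)%:C) +
    y h n w * (si ^+ 2 * (i [:: true; true] h n w)%:C +
    (ito_rest la si (fun a => i a h n w)
    - c h * ito_theta la si (fun a => i a h n w))))).
  by move=> h n w; rewrite ito_sumE; ring.
apply: ranOD; first exact: (ranOZ (detO_cst si) (H [:: true] isT)).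
by apply: ranO_weak (ranO_tail bc H); rewrite leq_add2l.
Qed.

(** In the two products, the lemmas on one interval are applied twice: the
    first time with an integral over the second interval as the factor y, the
    second time with the contribution of the first interval as the factor. *)
Lemma ranO_remainder (i1 i2 : multi_index -> R -> nat -> T -> R) :
  complex.Re la < 0 ->
  {in mi_set, forall a, ranO P (degree a) (fun h n w => (i1 a h n w)%:C)} ->
  {in mi_set, forall a, ranO P (degree a) (fun h n w => (i2 a h n w)%:C)} ->
  {in mi_set &, forall a b, ranO P (degree b + degree a)
     (fun h n w => (i2 b h n w)%:C * (i1 a h n w)%:C)} ->
  ranO P 3 (fun h n w =>
    remainder la si h (fun a => i1 a h n w) (fun a => i2 a h n w)).
Proof.
move=> la0 H1 H2 H12; have bb0 := detO_bb la0; have bt0 := detO_bt la0.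
have aa0 := detO_aa la0.
have one i : {in mi_set, forall a, ranO P (degree a) (fun h n w =>
  (i a h n w)%:C)} ->
    {in mi_set, forall a, ranO P (0 + degree a) (fun h n w =>
      1 * (i a h n w)%:C)}.
  move=> Hi a /Hi; apply: ranO_eq => h n w; by rewrite mul1r.
have defect i (c : R -> R[i]) : detO 2 c ->
    {in mi_set, forall a, ranO P (degree a) (fun h n w => (i a h n w)%:C)} ->
    ranO P 3 (fun h n w => ito_rest la si (fun a => i a h n w)
      - c h * ito_theta la si (fun a => i a h n w)).
  by move=> bc /one Hi; apply: ranO_eq (ranO_defect bc Hi) => h n w;
    rewrite mul1r.
have bh (c : R[i]) := detO_hM c.
rewrite /remainder; apply: ranOD; first apply: ranOD; first apply: ranOD;
  first apply: ranOD.
- apply: (ranOZ (j := 0)); last exact: defect.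
  exact: (detOM bt0 (detOM (detO_cst _) bb0)).
- apply: (ranOZ (j := 0)); last exact: defect.
  exact: (detOM bt0 (detO_cst _)).
- apply: (ranOZ (j := 0)); last exact: defect.
  exact: (detOM bt0 aa0).
- apply: (ranOZ (j := 0) (k := 3)).
    exact: (detOM (detOM bt0 bb0) (detO_cst _)).
  apply: (ranO_tail (k := 1) (bh _)) => a am.
  exact: (H12 a [:: true] am isT).
- apply: (ranOZ (j := 0) (k := 3)); first exact: (detOM bt0 bb0).
  apply: (ranO_tail (k := 1) (bh _)) => b bm.
  apply: (@ranO_eq _ _ _ _ _ (fun h n w => (i2 b h n w)%:C *
    (ito_sum la si (fun a => i1 a h n w) - h%:C * (1 / 2 * (gam R)%:C) *
      ito_theta la si (fun a => i1 a h n w)))).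
    by move=> h n w; rewrite mulrC.
  rewrite addnC; apply: (ranO_stage (bh _)) => a am.
  exact: H12.
Qed.

End RemainderOrder.

(** * The choice of the step size *)

Section SmallStep.
Context (R : realType).

(** The mean square of the factor is below 1 + (2 rl + s2 + eta (s2 + 1)) h +
    K h^2 with K depending on eta. First eta is chosen to make the coefficient
    of h equal to half of 2 rl + s2, then h so small that K h^2 cannot
    compensate it. *)
Lemma small_step (rl s2 CD Cc CG C3 : R) : 0 <= s2 -> 0 <= CD -> 0 <= Cc ->
  0 <= CG -> 0 <= C3 -> 2 * rl + s2 < 0 ->
  exists eta hs : R, [/\ 0 < eta, 0 < hs, hs <= 1 & forall h, 0 < h -> h < hs ->
    (1 + eta * h) * (1 + 2 * rl * h + CD * h ^+ 2 + (1 + eta) *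
      ((s2 + Cc * h) * h)
      + (1 + eta^-1) * (CG * h ^+ 2)) + (1 + (eta * h)^-1) * (C3 * h ^+ 3) < 1].
Proof.
move=> s0 CD0 Cc0 CG0 C30 neg; pose dl := - (2 * rl + s2).
have dl0 : 0 < dl by rewrite oppr_gt0.
have s1 : 0 < s2 + 1 by rewrite ltr_wpDl.
pose eta := dl / (2 * (s2 + 1)).
have e0 : 0 < eta by rewrite divr_gt0// mulr_gt0.
have ei0 : 0 < eta^-1 by rewrite invr_gt0.
have eE : eta * (s2 + 1) = dl / 2 by rewrite /eta; field; rewrite gt_eqF.
pose A := CD + (1 + eta) * Cc + (1 + eta^-1) * CG.
have A0 : 0 <= A by rewrite !addr_ge0// mulr_ge0// addr_ge0// ltW.
pose K1 := A + (1 + eta) * s2.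
have K10 : 0 <= K1 by rewrite addr_ge0// mulr_ge0// addr_ge0// ltW.
pose K2 := A + eta * K1 + C3 + eta^-1 * C3.
have K20 : 0 <= K2.
  have := mulr_ge0 (ltW e0) K10; have := mulr_ge0 (ltW ei0) C30.
  by rewrite /K2; lra.
have K21 : 0 < K2 + 1 by rewrite ltr_wpDl.
exists eta, (Num.min 1 (dl / 2 / (K2 + 1))); split => //.
- by rewrite lt_min ltr01 !divr_gt0.
- by rewrite ge_min lexx.
move=> h h0; rewrite lt_min => /andP[h1 h2].
have {}h2 : h * (K2 + 1) < dl / 2 by rewrite -ltr_pdivlMr.
set B := 1 + _ + _ + _ + _.
have hh : h ^+ 2 <= h by rewrite expr2 ler_piMl// ltW.
have h20 : 0 <= h ^+ 2 by exact: sqr_ge0.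
have h3 : h ^+ 3 <= h ^+ 2 by rewrite exprS ler_piMl// ltW.
have BE : B = 1 + (2 * rl + s2) * h + eta * s2 * h + A * h ^+ 2.
  by rewrite /B /A; ring.
have rl0 : (2 * rl + s2) * h <= 0 by rewrite mulr_le0_ge0// ltW.
have BK : B <= 1 + K1 * h.
  have : A * h ^+ 2 <= A * h by rewrite ler_wpM2l.
  have : 0 <= s2 * h by rewrite mulr_ge0// ltW.
  have -> : 1 + K1 * h = 1 + A * h + eta * s2 * h + s2 * h by rewrite /K1; ring.
  by rewrite BE; lra.
have -> : (1 + (eta * h)^-1) * (C3 * h ^+ 3) = C3 * h ^+ 3 + eta^-1 * C3 * h ^+
  2.
  by field; rewrite !gt_eqF.
have c3 : C3 * h ^+ 3 <= C3 * h ^+ 2 by rewrite ler_wpM2l.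
have eB : eta * h * B <= eta * h + eta * K1 * h ^+ 2.
  have -> : eta * h + eta * K1 * h ^+ 2 = eta * h * (1 + K1 * h) by ring.
  by rewrite ler_wpM2l// mulr_ge0// ltW.
rewrite mulrDl mul1r.
suff : B + (eta * h + eta * K1 * h ^+ 2) + (C3 * h ^+ 2 + eta^-1 * C3 * h ^+ 2)
  < 1 by lra.
have -> : B + (eta * h + eta * K1 * h ^+ 2) + (C3 * h ^+ 2 + eta^-1 * C3 * h ^+
  2) =
    1 + h * (2 * rl + s2 + eta * (s2 + 1) + h * K2).
  by rewrite BE /K2; ring.
rewrite eE gtrDl pmulr_rlt0//.
have : h * K2 <= h * (K2 + 1) by rewrite ler_wpM2l ?lerDl// ltW.
by rewrite /dl in h2 *; lra.
Qed.

End SmallStep.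

(** * The main part and stability *)

Section MainPart.
Local Open Scope complex_scope.
Context (R : realType) (d : measure_display) (T : measurableType d).
Context (P : probability T R).
Implicit Types (x : T -> R) (c : R[i]) (Z : T -> R[i]).

Definition cmean0 Z := mean0 P (fun w => complex.Re (Z w)) /\
  mean0 P (fun w => complex.Im (Z w)).

Lemma cmean0D Z Z' : cmean0 Z -> cmean0 Z' -> cmean0 (fun w => Z w + Z' w).
Proof.
move=> [a b] [a' b']; split.
  by under eq_fun do rewrite Re_addr; exact: mean0D.
by under eq_fun do rewrite Im_addr; exact: mean0D.
Qed.

Lemma cmean0Z c x : mean0 P x -> cmean0 (fun w => c * (x w)%:C).
Proof.
move=> x0; split.
  under eq_fun do rewrite Re_mulr /= mulr0 subr0; exact: mean0Z.
under eq_fun do rewrite Im_mulr /= mulr0 add0r; exact: mean0Z.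
Qed.

Lemma cmsq_lty Z : cmeas Z -> (cmsq P Z < +oo)%E ->
  (msq P (fun w => complex.Re (Z w)) < +oo)%E /\
  (msq P (fun w => complex.Im (Z w)) < +oo)%E.
Proof.
move=> mZ; rewrite cmsqE// => H; split; apply: le_lt_trans H.
  by rewrite leeDl// msq_ge0.
by rewrite leeDr// msq_ge0.
Qed.

(** The cross term with a constant vanishes for a centred Z. *)
Lemma cmsq_center c Z : cmeas Z -> cmean0 Z -> (cmsq P Z < +oo)%E ->
  (cmsq P (fun w => c + Z w)%R <= (sqn c)%:E + cmsq P Z)%E.
Proof.
move=> mZ [r0 i0] Zoo; have [Zr Zi] := cmsq_lty mZ Zoo.
rewrite cmsqE; last by apply: cmeasD => //; exact: cmeas_cst.
have [mr mi] := mZ.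
have step (a : R) x : measurable_fun setT x -> (msq P x < +oo)%E -> mean0 P x ->
    (msq P (fun w => a + x w)%R <= (a ^+ 2)%:E + msq P x)%E.
  move=> mx xoo x0; rewrite -(msq_cst P a).
  apply: msqD_orth => //; first by rewrite msq_cst ltry.
  exact: mean0Z.
rewrite cmsqE// EFinD [in leRHS]addeACA; apply: leeD.
  by under eq_fun do rewrite Re_addr; exact: step.
by under eq_fun do rewrite Im_addr; exact: step.
Qed.

Lemma cmsq_orth c1 c2 x1 x2 : measurable_fun setT x1 ->
  measurable_fun setT x2 ->
  (msq P x1 < +oo)%E -> (msq P x2 < +oo)%E -> mean0 P (fun w => x1 w * x2 w) ->
  (cmsq P (fun w => c1 * (x1 w)%:C + c2 * (x2 w)%:C)%R <=
   (sqn c1)%:E * msq P x1 + (sqn c2)%:E * msq P x2)%E.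
Proof.
move=> m1 m2 o1 o2 x12.
have step (a b : R) : (msq P (fun w => a * x1 w + b * x2 w)%R <=
    (a ^+ 2)%:E * msq P x1 + (b ^+ 2)%:E * msq P x2)%E.
  have fin (e : R) x : measurable_fun setT x -> (msq P x < +oo)%E ->
      (msq P (fun w => e * x w)%R < +oo)%E.
    by move=> mx xo; rewrite msqZ// lte_mul_pinfty// lee_fin sqr_ge0.
  rewrite -!msqZ//; apply: msqD_orth; try exact: fin;
    try exact: measurable_funM.
  rewrite (_ : (fun w => _) = (fun w => a * b * (x1 w * x2 w)));
    first exact: mean0Z.
  by apply/funext => w; ring.
rewrite cmsqE; last first.
  by apply: cmeasD; apply: cmeasM; (exact: cmeas_cst || exact: cmeasR).
rewrite /sqn !EFinD !ge0_muleDl ?lee_fin ?sqr_ge0// [in leRHS]addeACA;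
  apply: leeD.
  by under eq_fun do rewrite Re_addr !Re_mulr /= !mulr0 !subr0; exact: step.
by under eq_fun do rewrite Im_addr !Im_mulr /= !mulr0 !add0r; exact: step.
Qed.

End MainPart.

Section Stability.
Local Open Scope complex_scope.
Context (R : realType) (d : measure_display) (T : measurableType d).
Context (P : probability T R) (W : R -> {RV P >-> R}).
Context (I : multi_index -> R -> R -> T -> R) (la si : R[i]).
Hypothesis HW : wiener_process W.
Hypothesis HI : multiple_ito_integrals W I.

Let i1 (a : multi_index) (h : R) (n : nat) (w : T) := I a (tn h n) (tng h n) w.
Let i2 (a : multi_index) (h : R) (n : nat) (w : T) :=
  I a (tng h n) (tn h n.+1) w.

Lemma tn_ge0 (h : R) n : 0 < h -> 0 <= tn h n.
Proof. by move=> h0; rewrite mulr_ge0// ltW. Qed.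

Lemma tng_sub_tn (h : R) n : tng h n - tn h n = gam R * h.
Proof. by rewrite /tng addrC addKr. Qed.

Lemma tn_sub_tng (h : R) n : tn h n.+1 - tng h n = (1 - gam R) * h.
Proof. by rewrite /tng /tn -natr1; ring. Qed.

Lemma le_tn_tng (h : R) n : 0 < h -> tn h n <= tng h n.
Proof.
by move=> h0; rewrite -subr_ge0 tng_sub_tn mulr_ge0 ?ltW//; have /andP[] :=
  gam_bounds R.
Qed.

Lemma le_tng_tn (h : R) n : 0 < h -> tng h n <= tn h n.+1.
Proof.
by move=> h0; rewrite -subr_ge0 tn_sub_tng mulr_ge0 ?subr_ge0 ?ltW//;
  have /andP[] := gam_bounds R.
Qed.

Lemma tng_ge0 (h : R) n : 0 < h -> 0 <= tng h n.
Proof. by move=> h0; apply: le_trans (le_tn_tng n h0); exact: tn_ge0. Qed.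

Lemma mii_bound_scale (a : multi_index) (h c : R) : 0 < h -> 0 <= c -> c <= 1 ->
  0 <= mii_bound a (c * h) <= 4 ^+ mi_zeros a * h ^+ degree a.
Proof.
move=> h0 c0 c1; have ch : 0 <= c * h by rewrite mulr_ge0// ltW.
rewrite mii_bound_ge0//=; apply: (mii_bound_le a ch).
by rewrite ler_piMl// ltW.
Qed.

Let g01 : 0 <= gam R /\ gam R <= 1 /\ 0 <= 1 - gam R /\ 1 - gam R <= 1.
Proof. by have /andP[g0 g1] := gam_bounds R; do !split; lra. Qed.

Lemma ranO_first (a : multi_index) : ranO P (degree a) (fun h n w =>
  (i1 a h n w)%:C).
Proof.
have [g0 [g1 _]] := g01.
exists (4 ^+ mi_zeros a); first exact: exprn_ge0.
move=> h n h0 h1; have t0 := tn_ge0 n h0; have tt := le_tn_tng n h0.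
split; first exact/cmeasR/(measurable_mii HI).
rewrite cmsqR; apply: le_trans (msq_mii HW HI a t0 tt) _.
by rewrite lee_fin tng_sub_tn; have /andP[] := mii_bound_scale a h0 g0 g1.
Qed.

Lemma ranO_second (a : multi_index) : ranO P (degree a) (fun h n w =>
  (i2 a h n w)%:C).
Proof.
have [_ [_ [g0 g1]]] := g01.
exists (4 ^+ mi_zeros a); first exact: exprn_ge0.
move=> h n h0 h1; have t0 := tng_ge0 n h0; have tt := le_tng_tn n h0.
split; first exact/cmeasR/(measurable_mii HI).
rewrite cmsqR; apply: le_trans (msq_mii HW HI a t0 tt) _.
by rewrite lee_fin tn_sub_tng; have /andP[] := mii_bound_scale a h0 g0 g1.
Qed.

Lemma ranO_product (a b : multi_index) : ranO P (degree b + degree a)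
  (fun h n w => (i2 b h n w)%:C * (i1 a h n w)%:C).
Proof.
have [g0 [g1 [g0' g1']]] := g01.
apply: (@ranO_eq _ _ _ _ _ (fun h n w => (i2 b h n w * i1 a h n w)%:C)).
  by move=> h n w; rewrite rmorphM.
exists (4 * 4 ^+ mi_zeros b * 4 ^+ mi_zeros a); first by rewrite !mulr_ge0//
  exprn_ge0.
move=> h n h0 h1; have t0 := tn_ge0 n h0; have tt := le_tn_tng n h0.
have tt' := le_tng_tn n h0; have t0' := tng_ge0 n h0.
split; first by apply: cmeasR; apply: measurable_funM;
  exact: (measurable_mii HI).
rewrite cmsqR; apply: le_trans (msq_mii_mii HW HI a b t0 tt tt') _.
rewrite lee_fin tng_sub_tn tn_sub_tng exprD.
have /andP[a0 a1] := mii_bound_scale a h0 g0 g1.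
have /andP[b0 b1] := mii_bound_scale b h0 g0' g1'.
rewrite [leRHS](_ : _ = 4 * (4 ^+ mi_zeros b * h ^+ degree b) *
  (4 ^+ mi_zeros a * h ^+ degree a)); last by ring.
by apply: ler_pM => //; [rewrite mulr_ge0|rewrite ler_wpM2l].
Qed.

(** The deterministic part and the centred part are orthogonal, and so are the
    two increments; the terms of degree 2, gathered in G, are only separated
    by Young's inequality. *)
Lemma mean_square_main (D c1 c2 : R[i]) (G : T -> R[i]) (eta h : R) n : 0 < h ->
  0 < eta ->
  cmeas G -> cmean0 P G -> (cmsq P G < +oo)%E ->
  (cmsq P (fun w => D + (c1 * (i1 [:: true] h n w)%:C + c2 *
    (i2 [:: true] h n w)%:C + G w))%R <=
   (sqn D + (1 + eta) * (sqn c1 * (gam R * h) + sqn c2 * ((1 - gam R) * h)))%:E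
     +
   (1 + eta^-1)%:E * cmsq P G)%E.
Proof.
move=> h0 e0 mG G0 Goo.
have t0 := tn_ge0 n h0; have tt := le_tn_tng n h0.
have tt' := le_tng_tn n h0; have t0' := tng_ge0 n h0.
have m1 : measurable_fun setT (i1 [:: true] h n) := measurable_mii HI _ t0 tt.
have m2 : measurable_fun setT (i2 [:: true] h n) := measurable_mii HI _ t0' tt'.
have V1 : (msq P (i1 [:: true] h n) <= (gam R * h)%:E)%E.
  apply: le_trans (msq_mii HW HI [:: true] t0 tt) _.
  by rewrite tng_sub_tn /mii_bound /= expr0 mul1r expr1.
have V2 : (msq P (i2 [:: true] h n) <= ((1 - gam R) * h)%:E)%E.
  apply: le_trans (msq_mii HW HI [:: true] t0' tt') _.
  by rewrite tn_sub_tng /mii_bound /= expr0 mul1r expr1.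
have o1 : (msq P (i1 [:: true] h n) < +oo)%E := msq_mii_lty HW HI _ t0 tt.
have o2 : (msq P (i2 [:: true] h n) < +oo)%E := msq_mii_lty HW HI _ t0' tt'.
pose X w := c1 * (i1 [:: true] h n w)%:C + c2 * (i2 [:: true] h n w)%:C.
have mX : cmeas X.
  by apply: cmeasD; apply: cmeasM; (exact: cmeas_cst || exact: cmeasR).
have X0 : cmean0 P X.
  apply: cmean0D; apply: cmean0Z;
    [exact: (mean0_dW HW HI [::])|exact: (mean0_dW HW HI [::])].
have cmsqX : (cmsq P X <= (sqn c1 * (gam R * h) + sqn c2 *
  ((1 - gam R) * h))%:E)%E.
  apply: le_trans (cmsq_orth c1 c2 m1 m2 o1 o2 (mean0_dW_dW HW HI [::] [::] t0
    tt tt')) _.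
  by rewrite [in leRHS]EFinD; apply: leeD; rewrite [in leRHS]EFinM;
    apply: lee_wpmul2l; rewrite ?lee_fin ?sqn_ge0.
have e1 : 0 <= eta^-1 by rewrite invr_ge0 ltW.
have cmsqXG : (cmsq P (fun w => X w + G w)%R <=
    ((1 + eta) * (sqn c1 * (gam R * h) + sqn c2 * ((1 - gam R) * h)))%:E +
      (1 + eta^-1)%:E * cmsq P G)%E.
  apply: le_trans (cmsqD P e0 mX mG) _; apply: leeD => //.
  by rewrite [in leRHS]EFinM; apply: lee_wpmul2l => //;
    rewrite lee_fin addr_ge0// ltW.
apply: le_trans (cmsq_center D (cmeasD mX mG) (cmean0D X0 G0) _) _.
  apply: le_lt_trans cmsqXG _; rewrite lte_add_pinfty ?ltry// lte_mul_pinfty//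
    lee_fin addr_ge0//.
by rewrite [in leRHS]EFinD -[in leRHS]addeA; apply: leeD.
Qed.

(** The factor is split as M + remainder with M its terms of degree at most 2.
    *)
Lemma stability : 2 * complex.Re la + sqn si < 0 ->
  exists2 hs : R, 0 < hs & forall (h : R) (n : nat) (rho : T -> R[i]), 0 < h ->
    h < hs ->
    trbdf2_random_factor I h la si n rho -> (cmsq P rho < 1)%E.
Proof.
move=> neg; have la0 : complex.Re la < 0 by have := sqn_ge0 si; lra.
have [eD bD DE] := coefD_expand la0.
have [CD CD0 HD] := sqn_detO4 la bD.
have [e1 b1 c1E] := coef1_expand si la0.
have [C1 C10 H1] := sqn_detO2 si b1.
have [e2 b2 c2E] := coef2_expand si la0.
have [Cs C20 H2] := sqn_detO2 si b2.
pose G h n w := coef11 la si h * (i1 [:: true; true] h n w)%:C +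
  coef22 la si h * (i2 [:: true; true] h n w)%:C +
  coef12 la si h * ((i1 [:: true] h n w)%:C * (i2 [:: true] h n w)%:C).
have oG : ranO P 2 G.
  apply: ranOD; first apply: ranOD.
  - exact: (ranOZ (detO_coef11 si la0) (ranO_first [:: true; true])).
  - exact: (ranOZ (detO_coef22 si la0) (ranO_second [:: true; true])).
  - apply: (ranOZ (detO_coef12 si la0) (k := 2)).
    by apply: ranO_eq (ranO_product [:: true] [:: true]) => h n w;
      rewrite mulrC.
have [CG CG0 HG] := oG.
have [C3 C30 H3] : ranO P 3 (fun h n w =>
    remainder la si h (fun a => i1 a h n w) (fun a => i2 a h n w)).
  apply: ranO_remainder => //.
  - by move=> a _; exact: ranO_first.
  - by move=> a _; exact: ranO_second.
  - by move=> a b _ _; exact: ranO_product.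
have Cc0 : 0 <= C1 + Cs by rewrite addr_ge0.
have [eta [hs [eta0 hs0 hs1 small]]] := small_step (sqn_ge0 si) CD0 Cc0 CG0 C30
  neg.
exists hs => // h n rho h0 hhs Hrho; have h1 : h <= 1 :=
  ltW (lt_le_trans hhs hs1).
have {H3}[mE NE] := H3 h n h0 h1; have {HG oG}[mG NG] := HG h n h0 h1.
have t0 := tn_ge0 n h0; have tt := le_tn_tng n h0.
have tt' := le_tng_tn n h0; have t0' := tng_ge0 n h0.
pose M w := coefD la h + (coef1 la si h * (i1 [:: true] h n w)%:C +
  coef2 la si h * (i2 [:: true] h n w)%:C + G h n w).
have -> : rho = fun w => M w + remainder la si h (fun a => i1 a h n w) (fun a =>
  i2 a h n w).
  by apply/funext => w; exact: (trbdf2_factorE la0 h0 (Hrho w)).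
have m1 : measurable_fun setT (i1 [:: true] h n) := measurable_mii HI _ t0 tt.
have m2 : measurable_fun setT (i2 [:: true] h n) := measurable_mii HI _ t0' tt'.
have mM : cmeas M.
  apply: cmeasD; first exact: cmeas_cst.
  apply: (cmeasD _ mG).
  by apply: cmeasD; apply: cmeasM; (exact: cmeas_cst || exact: cmeasR).
have eh0 : 0 < eta * h by rewrite mulr_gt0.
have G0 : cmean0 P (G h n).
  apply: cmean0D; first apply: cmean0D.
  - by apply: cmean0Z; exact: (mean0_dW HW HI [:: true]).
  - by apply: cmean0Z; exact: (mean0_dW HW HI [:: true]).
  - under [X in cmean0 _ X]eq_fun do rewrite -rmorphM.
    by apply: cmean0Z; exact: (mean0_dW_dW HW HI [::] [::] t0 tt tt').
have Goo : (cmsq P (G h n) < +oo)%E by rewrite (le_lt_trans NG)// ltry.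
apply: le_lt_trans (cmsqD P eh0 mM mE) _.
have cmsqM := mean_square_main (coefD la h) (coef1 la si h) (coef2 la si h) n h0
  eta0 mG G0 Goo.
pose B := 1 + 2 * complex.Re la * h + CD * h ^+ 2 + (1 + eta) *
  ((sqn si + (C1 + Cs) * h) * h)
      + (1 + eta^-1) * (CG * h ^+ 2).
have {cmsqM}cmsqM : (cmsq P M <= B%:E)%E.
  apply: le_trans cmsqM _; rewrite /B [in leRHS]EFinD; apply: leeD; last first.
    rewrite [in leRHS]EFinM; apply: lee_wpmul2l => //.
    by rewrite lee_fin addr_ge0// invr_ge0 ltW.
  rewrite lee_fin; apply: lerD; first by rewrite DE//; exact: HD.
  rewrite ler_wpM2l ?(addr_ge0 ler01 (ltW eta0))// c1E// c2E//.
  have [g0 [g1 [g0' g1']]] := g01.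
  have K1 : sqn (si + e1 h) <= sqn si + (C1 + Cs) * h.
    apply: le_trans (H1 h h0 h1) _; rewrite lerD2l ler_wpM2r ?lerDl//;
      exact: ltW.
  have K2 : sqn (si + e2 h) <= sqn si + (C1 + Cs) * h.
    apply: le_trans (H2 h h0 h1) _; rewrite lerD2l ler_wpM2r ?lerDr//;
      exact: ltW.
  have -> : (sqn si + (C1 + Cs) * h) * h = (sqn si + (C1 + Cs) * h) *
    (gam R * h) +
    (sqn si + (C1 + Cs) * h) * ((1 - gam R) * h) by ring.
  by apply: lerD; rewrite ler_wpM2r// mulr_ge0// ltW.
apply: (@le_lt_trans _ _ (((1 + eta * h) * B + (1 + (eta * h)^-1) *
  (C3 * h ^+ 3))%:E)); last first.
  by rewrite lte_fin small.
rewrite [in leRHS]EFinD; apply: leeD; rewrite [in leRHS]EFinM;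
  apply: lee_wpmul2l => //.
  by rewrite lee_fin addr_ge0// ltW.
by rewrite lee_fin addr_ge0// invr_ge0 ltW.
Qed.

End Stability.

Local Open Scope complex_scope.

Theorem proposition4p4 (R : realType) (d : measure_display)
    (T : measurableType d) (P : probability T R) (W : R -> {RV P >-> R})
    (I : multi_index -> R -> R -> T -> R) (la si : R[i]) :
  wiener_process W -> multiple_ito_integrals W I ->
  2 * complex.Re la + Normc.normc si ^+ 2 < 0 ->
  exists2 hstar : R, 0 < hstar &
    forall (h : R) (n : nat) (rho : T -> R[i]), 0 < h -> h < hstar ->
      trbdf2_random_factor I h la si n rho -> MS_stable P rho.
Proof.
move=> HW HI; rewrite normc_sqr => /(stability HW HI)[hs hs0 H].
exists hs => // h n rho h0 hh Hrho; have := H h n rho h0 hh Hrho.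
rewrite /MS_stable unlock; congr (_ < _)%E.
by apply: eq_integral => w _; rewrite normc_sqr.
Qed.
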